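(* Let $\mathbf{k}$ be a commutative ring with $1$, $V=\mathbf{k}^n$, $S=\mathbf{k}[x_1,\ldots,x_n]=S(V)$. Fix integers $d,r,r'\geq 1$, let $R=S^{(d)}$, and consider the three $R$-modules $M=S^{(\geq r,d)}$, $M'=S^{(\geq r',d)}$, $M''=S^{(\geq r'',d)}$, where $r''=r+r'$. (i) The multiplication map $\varphi: M\otimes_R M'\to M''$ gives rise to a $GL(V)$-equivariant short exact sequence of $R$-modules $$0\to\mathbb{S}^{\sigma(r,r')}(V)(-r'')\to M\otimes_R M'\to M''\to 0$$ with the $R$-module $\mathbb{S}^{\sigma(r,r')}(V)(-r'')$ concentrated in degree $r''$ and annihilated by $R_+$. (ii) The sequence splits as $R$-modules, giving an $R$-module isomorphism $$M\otimes_R M'\cong M''\oplus\mathbb{S}^{\sigma(r,r')}(V)(-r'').$$ (iii) When $\binom{r+r'}{r}$ lies in $\mathbf{k}^\times$, the sequence also splits as $GL(V)$-representations.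
   Context: Let $x_1,\ldots,x_n$ be the $\mathbf{k}$-basis of $V$. $S=\bigoplus_j S_j$ has the standard grading, with $S_j=S^j(V)$ the $j$th symmetric power, and $GL(V)\cong GL_n(\mathbf{k})$ acts on $S$ by $\mathbf{k}$-algebra automorphisms extending its action on $V$. The $d$th Veronese subalgebra is $S^{(d)}=\bigoplus_{j\equiv 0 \bmod d}S_j$, and for $r\ge 0$, $S^{(\geq r,d)}=\bigoplus_{j\ge r,\ j\equiv r \bmod d}S_j$, an $S^{(d)}$-submodule of $S$. $R_+=S^{(\geq d,d)}$. Gradings are those inherited from $S$; $(-r'')$ indicates placement in degree $r''$. $\sigma(r,r')$ is the two-row ribbon skew diagram with bottom row of size $r$ and top row of size $r'$, in which the rightmost cell of the bottom row lies directly below the leftmost cell of the top row, with no other column overlap. Schur functors: for a finite diagram $D$ of cells (matrix-style coordinates, rows listed bottom-to-top $R_1,\dots,R_p$, columns listed left-to-right $C_1,\dots,C_c$), $\mathbb{S}^D(V)$ is the $GL(V)$-submodule of $S^{|R_1|}(V)\otimes_{\mathbf{k}}\cdots\otimes_{\mathbf{k}} S^{|R_p|}(V)$ that is the image of the composite $$\wedge^{|C_1|}(V)\otimes\cdots\otimes\wedge^{|C_c|}(V)\to V^{\otimes |D|}\to S^{|R_1|}(V)\otimes\cdots\otimes S^{|R_p|}(V),$$ where tensor positions of $V^{\otimes|D|}$ are indexed by cells of $D$, the first map is the tensor product over columns of the antisymmetrizations $v_1\wedge\cdots\wedge v_\ell\mapsto\sum_{w\in\mathfrak{S}_\ell}\operatorname{sgn}(w)\,v_{w(1)}\otimes\cdots\otimes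 v_{w(\ell)}$ (placed in the cells of that column from top to bottom), and the second map multiplies together the entries in each row. *)

(* Defs.v *)
From HB Require Import structures.
From mathcomp Require Import all_boot all_order all_fingroup all_algebra.
From mathcomp Require Import boolp.
From mathcomp.multinomials Require Import freeg mpoly.

Set Implicit Arguments.
Unset Strict Implicit.
Unset Printing Implicit Defensive.

Import GRing.Theory.
Local Open Scope ring_scope.
Local Open Scope quotient_scope.


Section Span.
Variables (A : nzRingType) (U : lmodType A) (G : U -> Prop).

(* The submodule generated by G, as the intersection of all submodules
   containing G. *)
Definition spanned (u : U) : Prop :=
  forall P : U -> Prop, P 0 ->
    (forall a x y, P x -> P y -> P (a *: x + y)) ->
    (forall x, G x -> P x) -> P u.

Definition span : {pred U} := fun u => `[< spanned u >].

Lemma spanP u : reflect (spanned u) (u \in span).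
Proof. exact: asboolP. Qed.

Lemma span_gen u : G u -> u \in span.
Proof. by move=> Gu; apply/spanP => P _ _; apply. Qed.

Lemma span_closed : submod_closed span.
Proof.
split=> [|a x y]; first by apply/spanP => P P0.
move=> /spanP hx /spanP hy; apply/spanP => P P0 PD PG.
by apply: (PD); [exact: (hx _ P0 PD PG) | exact: (hy _ P0 PD PG)].
Qed.

HB.instance Definition _ := GRing.isSubmodClosed.Build A U span span_closed.

(* U / <G>; the base-ring action is added to the library's quotient of a
   Z-module by a subgroup. *)
Definition lquot : Type := Quotient.quot span.

HB.instance Definition _ := Choice.on lquot.
HB.instance Definition _ := GRing.Zmodule.on lquot.

Definition lpi (u : U) : lquot := \pi_(Quotient.quot span) u.

Lemma lpi_eq x y : (lpi x == lpi y) = (x - y \in span).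
Proof. by rewrite [RHS]Quotient.idealrBE. Qed.

Definition lrepr (x : lquot) : U := generic_quotient.repr (x : Quotient.quot span).

Lemma lreprK x : lpi (lrepr x) = x.
Proof. exact: (@reprK _ (Quotient.quot span)). Qed.

Lemma lpiD : {morph lpi : x y / x + y}.
Proof. exact: Quotient.pi_add. Qed.

Definition lscale (a : A) (x : lquot) := lpi (a *: lrepr x).

Lemma lpiZ a u : lpi (a *: u) = lscale a (lpi u).
Proof.
apply/eqP; rewrite lpi_eq -scalerBr rpredZ // -lpi_eq lreprK.
exact: eqxx.
Qed.

Fact lscaleA a b x : lscale a (lscale b x) = lscale (a * b) x.
Proof. by rewrite -(lreprK x) -!lpiZ scalerA. Qed.
Fact lscale1 : left_id 1 lscale.
Proof. by move=> x; rewrite -(lreprK x) -lpiZ scale1r. Qed.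
Fact lscaleDr : right_distributive lscale +%R.
Proof.
move=> a x y; rewrite -(lreprK x) -(lreprK y).
by rewrite -lpiD -!lpiZ -lpiD scalerDr.
Qed.
Fact lscaleDl x : {morph lscale^~ x : a b / a + b}.
Proof. by move=> a b /=; rewrite -(lreprK x) -!lpiZ -lpiD scalerDl. Qed.

HB.instance Definition _ :=
  GRing.Zmodule_isLmodule.Build A lquot lscaleA lscale1 lscaleDr lscaleDl.

Lemma lpi_linear : linear lpi.
Proof. by move=> a x y; rewrite lpiD lpiZ. Qed.
HB.instance Definition _ := GRing.isLinear.Build A U lquot _ lpi lpi_linear.

Lemma lpi_rel u : G u -> lpi u = 0.
Proof. by move=> Gu; rewrite -(linear0 lpi); apply/eqP; rewrite lpi_eq subr0 span_gen. Qed.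

Section Lift.
Variables (N : lmodType A) (f : {linear U -> N}).
Hypothesis fG : forall u, G u -> f u = 0.

Definition llift (_ : forall u, G u -> f u = 0) (x : lquot) : N := f (lrepr x).

Lemma lliftE u : llift fG (lpi u) = f u.
Proof.
apply/eqP; rewrite -subr_eq0 -linearB; apply/eqP.
have: lrepr (lpi u) - u \in span by rewrite -lpi_eq lreprK.
move/spanP/(_ (fun v => f v = 0)); apply=> [|a x y fx fy|]; rewrite ?linear0 //.
by rewrite linearP fx fy scaler0 addr0.
Qed.

Lemma llift_linear : linear (llift fG).
Proof.
move=> a x y; rewrite -(lreprK x) -(lreprK y) -linearP !lliftE.
exact: linearP.
Qed.
HB.instance Definition _ :=
  GRing.isLinear.Build A lquot N _ (llift fG) llift_linear.
End Lift.

End Span.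


Section FreeModule.
Variables (A : nzRingType) (K : choiceType).
Implicit Types D : {freeg K / A}.

Lemma freegZU (a b : A) (x : K) : a *: << b *g x >> = << a * b *g x >>.
Proof. by apply/eqP/freeg_eqP => y; rewrite coeffZ !coeffU mulrA. Qed.

Lemma freegE D : D = \sum_(x <- dom D) coeff x D *: << x >>.
Proof.
rewrite -[LHS]freeg_sumE; apply: eq_bigr => x _.
by rewrite freegZU mulr1.
Qed.

Variables (N : lmodType A) (f : K -> N).

Lemma fglift_linear : linear (fglift f : {freeg K / A} -> N).
Proof.
have fB := @lift_is_additive A K N f.
have f0 : fglift f 0 = 0 by rewrite -(subrr 0) fB subrr.
have fN w : fglift f (- w) = - fglift f w by rewrite -sub0r fB f0 sub0r.
have fD u v : fglift f (u + v) = fglift f u + fglift f v.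
  by rewrite -(opprK v) fB !fN.
have fS (s : seq K) (F : K -> {freeg K / A}) :
    fglift f (\sum_(x <- s) F x) = \sum_(x <- s) fglift f (F x).
  by apply: (big_morph _ fD f0).
move=> a D E; rewrite fD; congr (_ + _).
rewrite {1}(freegE D) [in RHS](freegE D) scaler_sumr !fS scaler_sumr.
by apply: eq_bigr => x _; rewrite scalerA !freegZU !liftU !mulr1 scalerA.
Qed.
HB.instance Definition _ :=
  GRing.isLinear.Build A {freeg K / A} N _ (fglift f) fglift_linear.

Lemma fgliftE x : fglift f << x >> = f x.
Proof. by rewrite liftU scale1r. Qed.

End FreeModule.

Section Tensor.
Variables (A : comNzRingType) (M N : lmodType A).

(* M (x)_A N: the free A-module on pairs modulo bilinearity. The universal
   property is tlift, tliftE, tens_ind. *)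
Definition bilin_rel (u : {freeg (M * N) / A}) : Prop :=
  (exists a x1 x2 y,
     u = << (a *: x1 + x2, y) >> - a *: << (x1, y) >> - << (x2, y) >>) \/
  (exists a x y1 y2,
     u = << (x, a *: y1 + y2) >> - a *: << (x, y1) >> - << (x, y2) >>).

Definition tens : lmodType A := lquot bilin_rel.

Definition tmul (x : M) (y : N) : tens := lpi bilin_rel << (x, y) >>.

Lemma tmulPl a x1 x2 y :
  tmul (a *: x1 + x2) y = a *: tmul x1 y + tmul x2 y.
Proof.
apply/eqP; rewrite -subr_eq0 opprD addrA /tmul -linearZ -!linearB /=.
by apply/eqP/lpi_rel; left; exists a, x1, x2, y.
Qed.

Lemma tmulPr a x y1 y2 :
  tmul x (a *: y1 + y2) = a *: tmul x y1 + tmul x y2.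
Proof.
apply/eqP; rewrite -subr_eq0 opprD addrA /tmul -linearZ -!linearB /=.
by apply/eqP/lpi_rel; right; exists a, x, y1, y2.
Qed.

Definition bilin (P : lmodType A) (f : M -> N -> P) : Prop :=
  (forall a x1 x2 y, f (a *: x1 + x2) y = a *: f x1 y + f x2 y) /\
  (forall a x y1 y2, f x (a *: y1 + y2) = a *: f x y1 + f x y2).

Section Lift.
Variables (P : lmodType A) (f : M -> N -> P) (fP : bilin f).

Lemma tlift_rel u : bilin_rel u -> fglift (fun xy => f xy.1 xy.2) u = 0.
Proof.
case: fP => fl fr [[a [x1 [x2 [y ->]]]]|[a [x [y1 [y2 ->]]]]].
  by rewrite !linearB linearZ /= !fgliftE /= fl -addrA -opprD subrr.
by rewrite !linearB linearZ /= !fgliftE /= fr -addrA -opprD subrr.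
Qed.

Definition tlift : {linear tens -> P} := llift tlift_rel.

Lemma tliftE x y : tlift (tmul x y) = f x y.
Proof. exact: etrans (lliftE _ _) (fgliftE _ _). Qed.
End Lift.

Lemma tens_ind (P : tens -> Prop) :
  P 0 -> (forall a x y z, P z -> P (a *: tmul x y + z)) -> forall t, P t.
Proof.
move=> P0 PD t; rewrite -(lreprK t) (freegE (lrepr t)) linear_sum /=.
elim: (dom _) => [|[x y] s IH]; rewrite ?big_nil // big_cons linearZ.
exact: PD.
Qed.

End Tensor.

Section MultiTensor.
Variables (A : comNzRingType) (I : finType) (M : I -> lmodType A).

(* The tensor product of a finite family, with factors indexed by a finite type
   rather than ordered: x, x1, x2 agree off i, and the i-th slot is linear. *)
Definition mlin_rel (u : {freeg {dffun forall i, M i} / A}) : Prop :=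
  exists i a (x x1 x2 : {dffun forall i, M i}),
    [/\ x i = a *: x1 i + x2 i,
        forall j, j != i -> x j = x1 j,
        forall j, j != i -> x j = x2 j &
        u = << x >> - a *: << x1 >> - << x2 >>].

Definition mtens : lmodType A := lquot mlin_rel.

Definition mtmul (x : forall i, M i) : mtens :=
  lpi mlin_rel << [ffun i => x i] : {dffun forall i, M i} >>.

Definition mlin (P : lmodType A) (f : (forall i, M i) -> P) : Prop :=
  forall i a (x x1 x2 : forall i, M i),
    x i = a *: x1 i + x2 i ->
    (forall j, j != i -> x j = x1 j) -> (forall j, j != i -> x j = x2 j) ->
    f x = a *: f x1 + f x2.

Lemma mtmul_mlin : mlin mtmul.
Proof.
move=> i a x x1 x2 xi e1 e2.
apply/eqP; rewrite -subr_eq0 opprD addrA /mtmul -linearZ -!linearB /=.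
apply/eqP/lpi_rel; exists i, a, [ffun i => x i], [ffun i => x1 i], [ffun i => x2 i].
by split=> [|j ji|j ji|//]; rewrite !ffunE; [exact: xi | exact: e1 | exact: e2].
Qed.

Section Lift.
Variables (P : lmodType A) (f : (forall i, M i) -> P) (fP : mlin f).

Lemma mtlift_rel u :
  mlin_rel u -> fglift (fun x : {dffun forall i, M i} => f x) u = 0.
Proof.
move=> [i [a [x [x1 [x2 [xi e1 e2 ->]]]]]].
by rewrite !linearB linearZ /= !fgliftE (fP xi e1 e2) -addrA -opprD subrr.
Qed.

Definition mtlift : {linear mtens -> P} := llift mtlift_rel.

Lemma mtliftE x : mtlift (mtmul x) = f x.
Proof.
apply: etrans (lliftE _ _) _; apply: etrans (fgliftE _ _) _; congr f.
by apply: functional_extensionality_dep => i; rewrite ffunE.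
Qed.
End Lift.

Lemma mtens_ind (P : mtens -> Prop) :
  P 0 -> (forall a x z, P z -> P (a *: mtmul x + z)) -> forall t, P t.
Proof.
move=> P0 PD t; rewrite -(lreprK t) (freegE (lrepr t)) linear_sum /=.
elim: (dom _) => [|x s IH]; rewrite ?big_nil // big_cons linearZ.
have -> : x = [ffun i => x i] by apply/ffunP => i; rewrite ffunE.
exact: PD.
Qed.

End MultiTensor.

Section MultiTensorMap.
Variables (A : comNzRingType) (I : finType) (M N : I -> lmodType A).
Variable f : forall i, {linear M i -> N i}.

Lemma mtmap_mlin : mlin (fun x : forall i, M i => mtmul (fun i => f i (x i))).
Proof.
move=> i a x x1 x2 xi e1 e2; apply: (mtmul_mlin (i := i)) => [|j ji|j ji].
- by rewrite xi linearP.
- by rewrite e1.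
- by rewrite e2.
Qed.

Definition mtmap : {linear mtens M -> mtens N} := mtlift mtmap_mlin.

Lemma mtmapE x : mtmap (mtmul x) = mtmul (fun i => f i (x i)).
Proof. exact: mtliftE. Qed.
End MultiTensorMap.

Arguments llift : simpl never.
Arguments tlift : simpl never.
Arguments mtlift : simpl never.
Arguments mtmap : simpl never.

(* Multilinear maps are determined by their values on generators. *)
Section Expansion.
Variables (A : comNzRingType) (I : finType) (M : I -> lmodType A).
Variables (P : lmodType A) (S : forall i, M i -> Prop).
Arguments S : clear implicits.
Hypothesis genS : forall i x, spanned (S i) x.

Lemma mlin0 (F : (forall i, M i) -> P) x i : mlin F -> x i = 0 -> F x = 0.
Proof.
move=> FP xi; have := FP i 1 x x x; rewrite xi scaler0 addr0 scale1r.
move=> /(_ erefl (fun _ _ => erefl) (fun _ _ => erefl)) e.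
by apply: (addIr (F x)); rewrite add0r -e.
Qed.

Lemma mlin_eq (F G : (forall i, M i) -> P) :
  mlin F -> mlin G -> (forall x, (forall i, S i (x i)) -> F x = G x) ->
  forall x, F x = G x.
Proof.
move=> FP GP FG x.
suff: forall (s : seq I) y, (forall i, i \notin s -> S i (y i)) -> F y = G y.
  by move/(_ (enum I) x); apply=> i; rewrite mem_enum.
elim=> [|i s IH] y Sy; first by apply: FG => i; apply: Sy.
pose u z : forall j, M j := dfwith y (z : M i).
have ui z : u z i = z by rewrite /u dfwith_in.
have uj z z' j : j != i -> u z j = u z' j.
  by move=> ji; rewrite /u !dfwith_out // eq_sym.
have -> : y = u (y i).
  apply: functional_extensionality_dep => j.
  case: (eqVneq j i) => [->|ji]; first by rewrite ui.
  by rewrite /u dfwith_out // eq_sym.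
apply: (genS (y i) (P := fun z => F (u z) = G (u z))) => [|a z1 z2 h1 h2|z Sz].
- by rewrite !(mlin0 (i := i)) ?ui.
- have e z := @uj (a *: z1 + z2) z.
  rewrite (FP i a (u _) (u z1) (u z2)) ?ui //; [|exact: e|exact: e].
  rewrite (GP i a (u _) (u z1) (u z2)) ?ui //; [|exact: e|exact: e].
  by rewrite h1 h2.
- apply: IH => j js; case: (eqVneq j i) => [->|ji]; first by rewrite ui.
  rewrite /u dfwith_out 1?eq_sym //; apply: Sy.
  by rewrite inE negb_or ji.
Qed.
End Expansion.

Section PureTensors.
Variables (A : comNzRingType) (I : finType) (M : I -> lmodType A).
Lemma mtens_span (t : mtens M) : spanned (fun u => exists x, u = mtmul x) t.
Proof.
elim/mtens_ind: t => [P P0 //|a x z IH P P0 PD PG].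
by apply: (PD); [apply: PG; exists x | exact: (IH P P0 PD PG)].
Qed.
End PureTensors.

Notation tpow V I := (mtens (fun _ : I => V)).

Section Exterior.
Variables (A : comNzRingType) (V : lmodType A) (l : nat).

(* The l-th exterior power: V^(x)l modulo pure tensors with a repeated entry. *)
Definition alt_rel (u : tpow V 'I_l) : Prop :=
  exists v : 'I_l -> V, (exists i j, i != j /\ v i = v j) /\ u = mtmul v.

Definition ext : lmodType A := lquot alt_rel.

Definition wedge (v : 'I_l -> V) : ext := lpi alt_rel (mtmul v).

Definition antisym_fun (v : 'I_l -> V) : tpow V 'I_l :=
  \sum_(w : 'S_l) (-1) ^+ w *: mtmul (fun i => v (w i)).

Lemma antisym_mlin : mlin antisym_fun.
Proof.
move=> i a x x1 x2 xi e1 e2; rewrite /antisym_fun scaler_sumr -big_split /=.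
apply: eq_bigr => w _; rewrite scalerA mulrC -scalerA -scalerDr; congr (_ *: _).
have ne j : j != (w^-1)%g i -> w j != i.
  by apply: contraNneq => <-; rewrite permK.
apply: (mtmul_mlin (i := (w^-1)%g i)) => [|j /ne|j /ne].
- by rewrite permKV.
- exact: e1.
- exact: e2.
Qed.

Lemma antisym_rel u : alt_rel u -> mtlift antisym_mlin u = 0.
Proof.
move=> [v [[i [j [ij vij]]] ->]]; rewrite mtliftE /antisym_fun.
pose t := tperm i j.
have oddMt (s : 'S_l) : (s * t)%g = ~~ s :> bool.
  by rewrite odd_permM odd_tperm ij addbT.
rewrite (bigID (@odd_perm _)) /=.
apply: canLR (subrK _) _; rewrite add0r -sumrN.
rewrite (reindex_inj (mulIg t)); apply: eq_big => [s|s] /=; first by rewrite oddMt ?negbK.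
rewrite oddMt => /negPf->; rewrite expr1 expr0 scaleN1r scale1r; congr (- mtmul _).
apply: functional_extensionality_dep => a; rewrite permM /t.
by case: tpermP => [->|->|//].
Qed.

Definition antisym : {linear ext -> tpow V 'I_l} := llift antisym_rel.

Lemma antisymE v :
  antisym (wedge v) = \sum_(w : 'S_l) (-1) ^+ w *: mtmul (fun i => v (w i)).
Proof. exact: etrans (lliftE _ _) (mtliftE _ _). Qed.

Lemma ext_ind (P : ext -> Prop) :
  P 0 -> (forall a v z, P z -> P (a *: wedge v + z)) -> forall t, P t.
Proof.
move=> P0 PD t; rewrite -(lreprK t); elim/mtens_ind: (lrepr t) => [|a x z IH].
  by rewrite linear0.
by rewrite linearP; apply: PD.
Qed.

Variable f : {linear V -> V}.

Lemma extmap_rel u :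
  alt_rel u -> (lpi alt_rel \o mtmap (fun _ : 'I_l => f)) u = 0.
Proof.
move=> [v [[i [j [ij vij]]] ->]].
apply: etrans (congr1 (lpi alt_rel) (mtmapE _ _)) _; apply: lpi_rel.
by exists (fun i => f (v i)); split=> //; exists i, j; rewrite vij.
Qed.

Definition extmap : {linear ext -> ext} := llift extmap_rel.

Lemma extmapE v : extmap (wedge v) = wedge (fun i => f (v i)).
Proof.
apply: etrans (lliftE extmap_rel _) _.
exact: (congr1 (lpi alt_rel) (mtmapE (fun _ : 'I_l => f) v)).
Qed.

Lemma antisym_extmap t :
  antisym (extmap t) = mtmap (fun _ : 'I_l => f) (antisym t).
Proof.
elim/ext_ind: t => [|a v z IH]; first by rewrite !linear0.
rewrite !linearP IH extmapE !antisymE; congr (_ *: _ + _); rewrite linear_sum.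
by apply: eq_bigr => w _; rewrite linearZ /= mtmapE.
Qed.
End Exterior.

Section Diagram.
Variables (p c : nat) (D : {set 'I_p * 'I_c}).

(* A diagram with at most p rows and c columns; the cell (i, j) is in row i
   counted from the top and column j counted from the left, so that the
   increasing enumeration of a column goes from top to bottom. Empty rows and
   columns contribute a factor S^0(V) = k, resp. the 0-th exterior power k. *)
Definition cell : finType := {x : 'I_p * 'I_c | x \in D}.
Definition colset (j : 'I_c) : {set 'I_p} := [set i | (i, j) \in D].
Definition rowset (i : 'I_p) : {set 'I_c} := [set j | (i, j) \in D].

Lemma colcell_subproof j (a : 'I_#|colset j|) : (enum_val a, j) \in D.
Proof. by have := enum_valP a; rewrite inE. Qed.
Lemma rowcell_subproof i (b : 'I_#|rowset i|) : (i, enum_val b) \in D.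
Proof. by have := enum_valP b; rewrite inE. Qed.

Definition colcell j (a : 'I_#|colset j|) : cell :=
  exist _ (enum_val a, j) (colcell_subproof a).
Definition rowcell i (b : 'I_#|rowset i|) : cell :=
  exist _ (i, enum_val b) (rowcell_subproof b).

Lemma cell_col (x : cell) : (val x).1 \in colset (val x).2.
Proof. by rewrite inE -surjective_pairing (valP x). Qed.

Lemma cell_row (x : cell) : (val x).2 \in rowset (val x).1.
Proof. by rewrite inE -surjective_pairing (valP x). Qed.

Definition rowrank (x : cell) : 'I_#|rowset (val x).1| :=
  enum_rank_in (cell_row x) (val x).2.

Lemma rowcellK i (b : 'I_#|rowset i|) : rowrank (rowcell b) = b.
Proof. exact: enum_valK_in. Qed.

Lemma rowrankK x : rowcell (rowrank x) = x.
Proof.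
apply: val_inj; rewrite /= enum_rankK_in ?cell_row //.
by rewrite -surjective_pairing.
Qed.

Definition colrank (x : cell) : 'I_#|colset (val x).2| :=
  enum_rank_in (cell_col x) (val x).1.

Lemma colcellK j (a : 'I_#|colset j|) : colrank (colcell a) = a.
Proof. exact: enum_valK_in. Qed.

Lemma colrankK x : colcell (colrank x) = x.
Proof.
apply: val_inj; rewrite /= enum_rankK_in ?cell_col //.
by rewrite -surjective_pairing.
Qed.
End Diagram.
Arguments antisym : simpl never.
Arguments extmap : simpl never.

Section Coordinates.
Variables (k : comNzRingType) (n : nat).
Local Notation V := 'cV[k]_n.

Definition cvbase (i : 'I_n) : V := delta_mx i 0.

Lemma cvbase_span (v : V) : spanned (fun u => exists i, u = cvbase i) v.
Proof.
have -> : v = \sum_i v i 0 *: cvbase i.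
  rewrite {1}[v]matrix_sum_delta; apply: eq_bigr => i _.
  by rewrite big_ord1 /cvbase.
move=> P P0 PD PG; elim: (index_enum _) => [|i s IH]; first by rewrite big_nil.
by rewrite big_cons; apply: PD => //; apply: PG; exists i.
Qed.

Section TensorPower.
Variable I : finType.

Lemma coord_mlin (f : I -> 'I_n) :
  mlin (P := k^o) (fun v : I -> V => \prod_i v i (f i) 0).
Proof.
move=> i a x x1 x2 xi e1 e2; rewrite (bigD1 i) //= [X in _ = a *: X + _](bigD1 i) //=
  [X in _ = _ + X](bigD1 i) //= xi !mxE mulrDl -mulrA.
rewrite -[in RHS]/(a * _).
by congr (a * (_ * _) + _ * _); apply: eq_bigr => j ji; [rewrite e1|rewrite e2].
Qed.

Definition coord (f : I -> 'I_n) : {linear tpow V I -> k^o} :=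
  mtlift (coord_mlin f).

Lemma coordE f v : coord f (mtmul v) = \prod_i v i (f i) 0.
Proof. exact: mtliftE. Qed.

Definition ebase (f : I -> 'I_n) : tpow V I := mtmul (fun i => cvbase (f i)).

Lemma mtmul_expand (v : I -> V) :
  mtmul v = \sum_(f : {ffun I -> 'I_n}) (\prod_i v i (f i) 0) *: ebase f.
Proof.
have gen (i : I) x := @cvbase_span x.
pose G (v : I -> V) : tpow V I :=
  \sum_(f : {ffun I -> 'I_n}) (\prod_i v i (f i) 0) *: ebase f.
apply: (mlin_eq gen (F := fun v => mtmul v) (G := G)).
- exact: mtmul_mlin.
- move=> i a x x1 x2 xi e1 e2; rewrite /G scaler_sumr -big_split /=.
  apply: eq_bigr => f _; rewrite (@coord_mlin f i a x x1 x2 xi e1 e2).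
  by rewrite scalerDl scalerA.
- move=> x /fin_all_exists [h hx]; rewrite /G.
  rewrite (bigD1 [ffun i => h i]) //= big1 ?scale1r => [|i _]; last first.
    by rewrite hx ffunE mxE !eqxx.
  rewrite big1 ?addr0 => [|f fh]; last first.
    have [i fi] : exists i, f i != h i.
      apply/existsP; rewrite -negb_forall; apply: contra fh => /forallP e.
      by apply/eqP/ffunP => i; rewrite ffunE; apply/eqP.
    by rewrite (bigD1 i) //= hx mxE (negPf fi) mul0r scale0r.
  rewrite /ebase; congr mtmul; apply: functional_extensionality_dep => i.
  by rewrite hx ffunE.
Qed.
End TensorPower.

Section Diagram.
Variables (p c : nat) (D : {set 'I_p * 'I_c}).

Local Notation colpow := (mtens (fun j : 'I_c => tpow V 'I_#|colset D j|)).

Lemma flat_coord_mlin (f : cell D -> 'I_n) :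
  mlin (P := k^o) (fun t : forall j, tpow V 'I_#|colset D j| =>
    \prod_j coord (fun a => f (colcell a)) (t j)).
Proof.
move=> i a x x1 x2 xi e1 e2; rewrite (bigD1 i) //= [X in _ = a *: X + _](bigD1 i) //=
  [X in _ = _ + X](bigD1 i) //= xi linearP mulrDl.
rewrite -[in LHS]mulrA.
rewrite -[in RHS]/(a * _).
by congr (a * (_ * _) + _ * _); apply: eq_bigr => j ji; [rewrite e1|rewrite e2].
Qed.

(* The canonical identification of the tensor product over the columns of
   V^(x)|C_j| with V^(x)D, the a-th factor of column j going to the a-th cell of
   that column. It is written in coordinates on the standard basis of V = k^n;
   flattenE is the coordinate-free characterization. *)
Definition flat_coord (f : cell D -> 'I_n) : {linear colpow -> k^o} :=
  mtlift (flat_coord_mlin f).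

Definition flatten_fun (t : colpow) : tpow V (cell D) :=
  \sum_(f : {ffun cell D -> 'I_n}) flat_coord f t *: ebase f.

Lemma flatten_linear : linear flatten_fun.
Proof.
move=> a x y; rewrite /flatten_fun scaler_sumr -big_split /=.
by apply: eq_bigr => f _; rewrite linearP scalerDl scalerA.
Qed.
HB.instance Definition _ :=
  GRing.isLinear.Build k colpow (tpow V (cell D)) _ flatten_fun flatten_linear.
Definition flatten : {linear colpow -> tpow V (cell D)} := flatten_fun.

Lemma flattenE (v : cell D -> V) :
  flatten (mtmul (fun j => mtmul (fun a : 'I_#|colset D j| => v (colcell a)))) =
  mtmul v.
Proof.
rewrite [RHS]mtmul_expand; apply: eq_bigr => f _; congr (_ *: _).
rewrite /flat_coord mtliftE.
under eq_bigr => j _ do rewrite coordE.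
rewrite sig_big_dep /=.
rewrite (reindex (fun x : cell D => Tagged (fun j => 'I_#|colset D j|) (colrank x))) /=.
  by apply: eq_bigr => x _; rewrite colrankK.
exists (fun u => colcell (tagged u)) => [x _|[j a] _] /=; first exact: colrankK.
by rewrite -[in RHS](colcellK a).
Qed.
End Diagram.
End Coordinates.
Arguments coord : simpl never.
Arguments flat_coord : simpl never.
Arguments flatten {k n p c} D : simpl never.

Section Polynomials.
Variables (k : comNzRingType) (n : nat).
Local Notation V := 'cV[k]_n.
Local Notation S := {mpoly k[n]}.

(* The inclusion of V = k^n as the degree-one part of S = k[x_1, ..., x_n]. *)
Definition linform (v : V) : S := \sum_i v i 0 *: 'X_i.

Lemma linform_linear : linear linform.
Proof.
move=> a u v; rewrite /linform scaler_sumr -big_split /=.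
by apply: eq_bigr => i _; rewrite !mxE scalerDl scalerA.
Qed.
HB.instance Definition _ := GRing.isLinear.Build k V S _ linform linform_linear.

Lemma linform_homog v : linform v \is 1.-homog.
Proof. by apply: rpred_sum => i _; apply: rpredZ; rewrite dhomogX /= mdeg1. Qed.

Lemma prod_homog m (F : 'I_m -> S) :
  (forall b, F b \is 1.-homog) -> \prod_b F b \is m.-homog.
Proof.
elim: m F => [|m IH] F hF; first by rewrite big_ord0 dhomog1.
by rewrite big_ord_recl (@dhomogM _ _ _ 1 _ m) ?hF ?IH.
Qed.

Section Action.
Variable g : 'M[k]_n.

(* The algebra map with x_j |-> \sum_i g_ij x_i, extending v |-> g v on V
   (gl_poly_linform). *)
Definition gl_tuple : n.-tuple S := [tuple linform (col j g) | j < n].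

Definition gl_poly (p : S) : S := p \mPo gl_tuple.

HB.instance Definition _ := GRing.RMorphism.copy gl_poly (comp_mpoly gl_tuple).
HB.instance Definition _ := GRing.Linear.copy gl_poly (comp_mpoly gl_tuple).

Lemma gl_poly_linform v : gl_poly (linform v) = linform (g *m v).
Proof.
rewrite {1}/linform linear_sum /=.
under eq_bigr => i _.
  rewrite linearZ /= /gl_poly comp_mpolyXU -tnth_nth tnth_mktuple -linearZ /=.
  over.
rewrite -linear_sum; congr linform; apply/colP => i.
rewrite summxE !mxE; apply: eq_bigr => j _.
by rewrite !mxE mulrC.
Qed.

Lemma gl_mnm_homog m : gl_poly 'X_[m] \is (mdeg m).-homog.
Proof.
rewrite /gl_poly comp_mpolyX mdegE.
elim/big_ind2: _ => [|d1 p1 d2 p2 h1 h2|i _]; rewrite ?dhomog1 ?dhomogM //.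
rewrite tnth_mktuple -[X in X.-homog]mul1n.
exact/dhomogMn/linform_homog.
Qed.

Lemma gl_poly_homog m p : p \is m.-homog -> gl_poly p \is m.-homog.
Proof.
move/dhomogP => hp; rewrite [p]mpolyE linear_sum big_seq.
by apply: rpred_sum => u /hp <-; rewrite linearZ rpredZ // gl_mnm_homog.
Qed.

Definition gl_sym_fun m (p : dhomog n k m) : dhomog n k m :=
  DHomog (gl_poly_homog (dhomog_is_dhomog p)).

Lemma gl_sym_linear m : linear (@gl_sym_fun m).
Proof. by move=> a p q; apply: val_inj; rewrite /= linearP. Qed.
HB.instance Definition _ m := GRing.isLinear.Build k (dhomog n k m)
  (dhomog n k m) _ (@gl_sym_fun m) (@gl_sym_linear m).
Definition gl_sym m : {linear dhomog n k m -> dhomog n k m} := @gl_sym_fun m.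
End Action.

Section Schur.
Variables (p c : nat) (D : {set 'I_p * 'I_c}).

(* The tensor product over the rows R_i of S^|R_i|(V), where S^m(V) is the
   degree-m part of S. *)
Definition symrows : lmodType k :=
  mtens (fun i : 'I_p => dhomog n k #|rowset D i|).

Definition rowprod (v : cell D -> V) (i : 'I_p) : dhomog n k #|rowset D i| :=
  DHomog (prod_homog (fun b : 'I_#|rowset D i| => linform_homog (v (rowcell b)))).

Lemma rowmul_mlin : mlin (fun v : cell D -> V => mtmul (rowprod v)).
Proof.
move=> x a v v1 v2 vx e1 e2.
pose b := enum_rank_in (cell_row x) (val x).2.
have xb : rowcell b = x by exact: rowrankK.
have ne (b' : 'I_#|rowset D (val x).1|) : b' != b -> rowcell b' != x.
  apply: contra => /eqP /(congr1 (fun y : cell D => (val y).2)) /= e.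
  by rewrite -(enum_valK_in (cell_row x) b') e.
have ne' i (b' : 'I_#|rowset D i|) : i != (val x).1 -> rowcell b' != x.
  by apply: contraNneq => <-.
apply: (mtmul_mlin (i := (val x).1)) => [|i hi|i hi].
- apply: val_inj => /=; rewrite (bigD1 b) //= [in RHS](bigD1 b) //=.
  rewrite [X in _ = _ + X](bigD1 b) //= xb vx linearP mulrDl -scalerAl.
  by congr (_ *: (_ * _) + _ * _); apply: eq_bigr => b' /ne hb; [rewrite e1|rewrite e2].
- by apply: val_inj => /=; apply: eq_bigr => b' _; rewrite e1 ?ne'.
- by apply: val_inj => /=; apply: eq_bigr => b' _; rewrite e2 ?ne'.
Qed.

Definition rowmul : {linear tpow V (cell D) -> symrows} := mtlift rowmul_mlin.

Lemma rowmulE v : rowmul (mtmul v) = mtmul (rowprod v).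
Proof. exact: mtliftE. Qed.

Local Notation extcols := (mtens (fun j : 'I_c => ext V #|colset D j|)).

(* /\(col 1) (x) ... (x) /\(col c) -> V^(x)D -> (x)_i S^|R_i|(V):
   antisymmetrize columns, then multiply along rows. The Schur functor is the
   image. *)
Definition schur_map : {linear extcols -> symrows} :=
  rowmul \o (flatten D \o mtmap (fun j => antisym V #|colset D j|)).

Definition schur_pred : {pred symrows} :=
  fun y => `[< exists t, schur_map t = y >].

Lemma schur_closed : submod_closed schur_pred.
Proof.
split=> [|a x y /asboolP[s <-] /asboolP[t <-]]; apply/asboolP.
  by exists 0; rewrite linear0.
by exists (a *: s + t); rewrite linearP.
Qed.
HB.instance Definition _ :=
  GRing.isSubmodClosed.Build k symrows schur_pred schur_closed.

Record schur := Schur { schur_val :> symrows; _ : schur_val \in schur_pred }.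
HB.instance Definition _ := [isSub for schur_val].
HB.instance Definition _ := [Choice of schur by <:].
HB.instance Definition _ := [SubChoice_isSubLmodule of schur by <:].

Variable g : 'M[k]_n.

Definition gl_rows : {linear symrows -> symrows} :=
  mtmap (fun i => gl_sym g #|rowset D i|).

Lemma gl_rowmul t :
  gl_rows (rowmul t) = rowmul (mtmap (fun _ => mulmx g) t).
Proof.
elim/mtens_ind: t => [|a v t IH]; first by rewrite !linear0.
rewrite !linearP IH mtmapE !rowmulE /gl_rows mtmapE; congr (_ *: mtmul _ + _).
apply: functional_extensionality_dep => i; apply: val_inj => /=.
by rewrite rmorph_prod; apply: eq_bigr => b _; exact: gl_poly_linform.
Qed.

Lemma gl_flatten t :
  flatten D (mtmap (fun j : 'I_c => mtmap (fun _ : 'I_#|colset D j| => mulmx g)) t) =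
  mtmap (fun _ => mulmx g) (flatten D t).
Proof.
elim/mtens_ind: t => [|a x t IH]; first by rewrite !linear0.
rewrite !linearP IH; congr (_ *: _ + _).
pose gen (j : 'I_c) (y : tpow V 'I_#|colset D j|) := mtens_span y.
pose gc (j : 'I_c) := mtmap (fun _ : 'I_#|colset D j| => mulmx g : {linear V -> V}).
apply: (mlin_eq gen (F := fun x => flatten D (mtmap gc (mtmul x)))
  (G := fun x => mtmap (fun _ => mulmx g) (flatten D (mtmul x)))).
- by move=> j b y y1 y2 ? ? ?; rewrite (@mtmul_mlin _ _ _ j b y y1 y2) // !linearP.
- by move=> j b y y1 y2 ? ? ?; rewrite (@mtmul_mlin _ _ _ j b y y1 y2) // !linearP.
move=> y /fin_all_exists [w hw].
pose v (u : cell D) := w (val u).2 (colrank u).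
have -> : y = fun j => mtmul (fun a : 'I_#|colset D j| => v (colcell a)).
  apply: functional_extensionality_dep => j; rewrite hw; congr mtmul.
  by apply: functional_extensionality_dep => b; rewrite /v colcellK.
rewrite flattenE !mtmapE -flattenE; congr (flatten D (mtmul _)).
by apply: functional_extensionality_dep => j; rewrite /gc mtmapE.
Qed.

Lemma gl_schur_map t :
  gl_rows (schur_map t) =
  schur_map (mtmap (fun j => extmap #|colset D j| (mulmx g)) t).
Proof.
rewrite /schur_map /= gl_rowmul -gl_flatten; congr (rowmul (flatten D _)).
elim/mtens_ind: t => [|a x t IH]; first by rewrite !linear0.
rewrite !linearP IH !mtmapE; congr (_ *: mtmul _ + _).
by apply: functional_extensionality_dep => j; rewrite antisym_extmap.
Qed.

Lemma gl_schur_subproof (x : schur) : gl_rows (val x) \in schur_pred.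
Proof.
case: x => _ /= /asboolP[t <-]; apply/asboolP.
by rewrite gl_schur_map; eexists.
Qed.

Definition gl_schur (x : schur) : schur := Schur (gl_schur_subproof x).

End Schur.
End Polynomials.
Arguments rowmul {k n p c} D : simpl never.
Arguments schur_map {k n p c} D : simpl never.
Arguments gl_rows {k n p c} D g : simpl never.

Section DegreeSets.
Variables (k : comNzRingType) (n : nat).
Implicit Types (P Q : pred nat) (p q : {mpoly k[n]}).

(* The direct sum of the S_j with P j. *)
Definition degs P : {pred {mpoly k[n]}} :=
  fun p => all (fun m => P (mdeg m)) (msupp p).

Lemma degsP P p : reflect (forall m, m \in msupp p -> P (mdeg m)) (p \in degs P).
Proof. exact: allP. Qed.

Lemma degs_closed P : submod_closed (degs P).
Proof.
split=> [|a p q /degsP hp /degsP hq]; first by apply/degsP => m; rewrite msupp0.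
apply/degsP => m /msuppD_le; rewrite mem_cat => /orP[/msuppZ_le/hp//|/hq//].
Qed.
HB.instance Definition _ P :=
  GRing.isSubmodClosed.Build k {mpoly k[n]} (degs P) (degs_closed P).

Lemma degsM P Q (T : pred nat) p q :
  (forall a b, P a -> Q b -> T (a + b)%N) ->
  p \in degs P -> q \in degs Q -> p * q \in degs T.
Proof.
move=> PQ /degsP hp /degsP hq; apply/degsP => m /msuppM_le /allpairsP[[u v]] /=.
by case=> /hp hu /hq hv ->; rewrite mdegD PQ.
Qed.

Lemma degsC P (a : k) : P 0%N -> a%:MP \in degs P.
Proof.
move=> P0; apply/degsP => m; rewrite msuppC; case: eqP => // _.
by rewrite inE => /eqP ->; rewrite mdeg0.
Qed.

Lemma gl_degs P (g : 'M[k]_n) p : p \in degs P -> gl_poly g p \in degs P.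
Proof.
move/degsP => hp; rewrite [p]mpolyE linear_sum big_seq.
apply: rpred_sum => u /hp Pu; rewrite linearZ rpredZ //.
by apply/degsP => m /(dhomogP _ _ _ (gl_mnm_homog g u)) ->.
Qed.

End DegreeSets.

Section Veronese.
Variables (k : comNzRingType) (n d : nat).
Local Notation S := {mpoly k[n]}.

(* The Veronese subalgebra S^(d). *)
Definition ver_pred : {pred S} := degs (fun j => d %| j)%N.

Lemma ver_closed : subring_closed ver_pred.
Proof.
split=> [|p q hp hq|p q]; first by rewrite -mpolyC1 degsC ?dvdn0.
  by rewrite /ver_pred rpredB.
by apply: degsM => a b; apply: dvdn_add.
Qed.
HB.instance Definition _ := GRing.isSubringClosed.Build S ver_pred ver_closed.

Record veronese := Ver { ver_val :> S; _ : ver_val \in ver_pred }.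
HB.instance Definition _ := [isSub for ver_val].
HB.instance Definition _ := [Choice of veronese by <:].
HB.instance Definition _ := [SubChoice_isSubComNzRing of veronese by <:].

Lemma verC_subproof (a : k) : a%:MP \in ver_pred.
Proof. by rewrite degsC ?dvdn0. Qed.
Definition verC (a : k) : veronese := Ver (verC_subproof a).

Section Module.
Variable r : nat.

(* S^(>= r, d), a module over S^(d). *)
Definition vermod_pred : {pred S} :=
  degs (fun j => (r <= j)%N && (j == r %[mod d])%N).

Lemma vermod_closed : zmod_closed vermod_pred.
Proof. by split=> [|p q]; [exact: rpred0 | exact: rpredB]. Qed.
HB.instance Definition _ := GRing.isZmodClosed.Build S vermod_pred vermod_closed.

Record vermod := VerMod { vermod_val :> S; _ : vermod_val \in vermod_pred }.
HB.instance Definition _ := [isSub for vermod_val].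
HB.instance Definition _ := [Choice of vermod by <:].
HB.instance Definition _ := [SubChoice_isSubZmodule of vermod by <:].

Lemma verscale_subproof (f : veronese) (x : vermod) :
  val f * val x \in vermod_pred.
Proof.
apply: degsM (valP f) (valP x) => a b /= da /andP[rb /eqP eb].
rewrite (leq_trans rb (leq_addl _ _)) /=.
by rewrite -modnDml (eqP da) add0n eb.
Qed.
Definition verscale f x : vermod := VerMod (verscale_subproof f x).

Fact verscaleA f h x : verscale f (verscale h x) = verscale (f * h) x.
Proof. by apply: val_inj; rewrite /= mulrA. Qed.
Fact verscale1 : left_id 1 verscale.
Proof. by move=> x; apply: val_inj; rewrite /= mul1r. Qed.
Fact verscaleDr : right_distributive verscale +%R.
Proof. by move=> f x y; apply: val_inj; rewrite /= mulrDr. Qed.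
Fact verscaleDl x : {morph verscale^~ x : f h / f + h}.
Proof. by move=> f h; apply: val_inj; rewrite /= mulrDl. Qed.
HB.instance Definition _ := GRing.Zmodule_isLmodule.Build veronese vermod
  verscaleA verscale1 verscaleDr verscaleDl.

Lemma gl_vermod_subproof (g : 'M[k]_n) (x : vermod) :
  gl_poly g (val x) \in vermod_pred.
Proof. exact: gl_degs (valP x). Qed.
Definition gl_vermod g (x : vermod) : vermod := VerMod (gl_vermod_subproof g x).

Definition vermod_homog (j : nat) (x : vermod) : Prop := val x \is j.-homog.

End Module.

Lemma gl_ver_subproof (g : 'M[k]_n) (f : veronese) :
  gl_poly g (val f) \in ver_pred.
Proof. exact: gl_degs (valP f). Qed.
Definition gl_ver g (f : veronese) : veronese := Ver (gl_ver_subproof g f).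

Lemma gl_ver_zmod g : zmod_morphism (gl_ver g).
Proof. by move=> f h; apply: val_inj; rewrite /= rmorphB. Qed.
Lemma gl_ver_monoid g : monoid_morphism (gl_ver g).
Proof.
by split=> [|f h]; apply: val_inj; rewrite /= (rmorph1, rmorphM).
Qed.
HB.instance Definition _ g :=
  GRing.isZmodMorphism.Build veronese veronese (gl_ver g) (gl_ver_zmod g).
HB.instance Definition _ g :=
  GRing.isMonoidMorphism.Build veronese veronese (gl_ver g) (gl_ver_monoid g).

Section Product.
Variables r r' : nat.

Lemma vermul_subproof (x : vermod r) (y : vermod r') :
  val x * val y \in vermod_pred (r + r').
Proof.
apply: degsM (valP x) (valP y) => a b /= /andP[ra /eqP ea] /andP[rb /eqP eb].
by rewrite leq_add //= -modnDm ea eb modnDm.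
Qed.
Definition vermul x y : vermod (r + r') := VerMod (vermul_subproof x y).

Lemma vermul_bilin : bilin vermul.
Proof.
split=> [a x1 x2 y|a x y1 y2]; apply: val_inj => /=.
  by rewrite mulrDl mulrA.
by rewrite mulrDr mulrCA.
Qed.

Definition mult_map : {linear tens (vermod r) (vermod r') -> vermod (r + r')} :=
  tlift vermul_bilin.
End Product.

End Veronese.

(* Restriction of scalars along s, used to lift s-semilinear maps. *)
Definition twist (R : comNzRingType) (s : {rmorphism R -> R})
  (N : lmodType R) : Type := N.

Section Twist.
Variables (R : comNzRingType) (s : {rmorphism R -> R}) (N : lmodType R).
Local Notation twist := (twist s N).

HB.instance Definition _ := GRing.Zmodule.on twist.

Definition twist_scale (a : R) (x : twist) : twist := s a *: (x : N).
Fact twist_scaleA a b x : twist_scale a (twist_scale b x) = twist_scale (a * b) x.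
Proof. by rewrite /twist_scale rmorphM scalerA. Qed.
Fact twist_scale1 : left_id 1 twist_scale.
Proof. by move=> x; rewrite /twist_scale rmorph1 scale1r. Qed.
Fact twist_scaleDr : right_distributive twist_scale +%R.
Proof. by move=> a x y; exact: scalerDr. Qed.
Fact twist_scaleDl x : {morph twist_scale^~ x : a b / a + b}.
Proof. by move=> a b; rewrite /twist_scale rmorphD; exact: scalerDl. Qed.
HB.instance Definition _ := GRing.Zmodule_isLmodule.Build R twist
  twist_scaleA twist_scale1 twist_scaleDr twist_scaleDl.
End Twist.

Section TensorAction.
Variables (k : comNzRingType) (n d r r' : nat).
Local Notation M := (vermod k n d r).
Local Notation M' := (vermod k n d r').
Local Notation T := (tens M M').

Lemma gl_tens_bilin (g : 'M[k]_n) :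
  bilin (P := twist (gl_ver g) T)
    (fun (x : M) (y : M') => tmul (gl_vermod g x) (gl_vermod g y)).
Proof.
split=> [a x1 x2 y|a x y1 y2].
  rewrite -[RHS]tmulPl; congr tmul; apply: val_inj => /=.
  by rewrite rmorphD rmorphM.
rewrite -[RHS]tmulPr; congr tmul; apply: val_inj => /=.
by rewrite rmorphD rmorphM.
Qed.

(* The diagonal action; it is semilinear over the action on S^(d). *)
Definition gl_tens (g : 'M[k]_n) : T -> T := tlift (gl_tens_bilin g).

Lemma gl_tensE g x y :
  gl_tens g (tmul x y) = tmul (gl_vermod g x) (gl_vermod g y).
Proof. exact: (tliftE (gl_tens_bilin g)). Qed.

(* The degree-j part of the tensor product: the additive subgroup generated by
   the products of homogeneous elements of degrees a and b with a + b = j. *)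
Definition tens_homog (j : nat) (t : T) : Prop :=
  forall P : T -> Prop, P 0 -> (forall u v, P u -> P v -> P (u - v)) ->
    (forall a b (x : M) (y : M'), (a + b)%N = j ->
      vermod_homog a x -> vermod_homog b y -> P (tmul x y)) ->
    P t.
End TensorAction.

(* The k-module W as an S^(d)-module on which f acts as its constant term, i.e.
   through S^(d) -> S^(d)/R_+ = k. Placed in degree s it has the grading
   conc_homog s. *)
Definition concentrated (k : comNzRingType) (n d : nat) (W : lmodType k) : Type :=
  W.

Section Concentrated.
Variables (k : comNzRingType) (n d : nat) (W : lmodType k).
Local Notation concentrated := (concentrated n d W).

HB.instance Definition _ := GRing.Zmodule.on concentrated.

Definition conc_scale (f : veronese k n d) (x : concentrated) : concentrated :=
  (val f)@_0%MM *: (x : W).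
Fact conc_scaleA f h x : conc_scale f (conc_scale h x) = conc_scale (f * h) x.
Proof. by rewrite /conc_scale scalerA /= (rmorphM (mcoeff 0)). Qed.
Fact conc_scale1 : left_id 1 conc_scale.
Proof. by move=> x; rewrite /conc_scale /= mcoeff1 eqxx scale1r. Qed.
Fact conc_scaleDr : right_distributive conc_scale +%R.
Proof. by move=> f x y; exact: scalerDr. Qed.
Fact conc_scaleDl x : {morph conc_scale^~ x : f h / f + h}.
Proof. by move=> f h; rewrite /conc_scale /= mcoeffD; exact: scalerDl. Qed.
HB.instance Definition _ := GRing.Zmodule_isLmodule.Build (veronese k n d)
  concentrated conc_scaleA conc_scale1 conc_scaleDr conc_scaleDl.

Definition conc_homog (s j : nat) (x : concentrated) : Prop := j = s \/ x = 0.
End Concentrated.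

(* Row 0 is the top row (columns r - 1, ..., r + r' - 2), row 1 the bottom row
   (columns 0, ..., r - 1); the two overlap in column r - 1 only. *)
Definition ribbon (r r' : nat) : {set 'I_2 * 'I_(r + r').-1} :=
  [set x : 'I_2 * 'I_(r + r').-1 |
     if x.1 == ord0 then (r.-1 <= x.2)%N else (x.2 < r)%N].

Definition short_exact (R : nzRingType) (A B C : lmodType R)
    (f : A -> B) (g : B -> C) : Prop :=
  [/\ injective f, forall y, g y = 0 <-> exists x, f x = y &
      forall z, exists y, g y = z].

Definition graded (A B : Type) (hA : nat -> A -> Prop) (hB : nat -> B -> Prop)
    (f : A -> B) : Prop :=
  forall j x, hA j x -> hB j (f x).

Definition equivariant (k : comUnitRingType) (n : nat) (A B : Type)
    (actA : 'M[k]_n -> A -> A) (actB : 'M[k]_n -> B -> B) (f : A -> B) : Prop :=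
  forall g, g \in unitmx -> forall x, f (actA g x) = actB g (f x).

(* A module over S^(d) is a k-module through the constant polynomials verC. *)
Definition k_linear (k : comNzRingType) (n d : nat)
    (A B : lmodType (veronese k n d)) (f : A -> B) : Prop :=
  forall (a : k) x y,
    f (verC n d a *: x + y) = verC n d a *: f x + f y.

(* Main.v *)
Require Import Defs.
From HB Require Import structures.
From mathcomp Require Import all_boot all_order all_fingroup all_algebra.
From mathcomp Require Import boolp zify.
From mathcomp.multinomials Require Import ssrcomplements freeg mpoly.

Set Implicit Arguments.
Unset Strict Implicit.
Unset Printing Implicit Defensive.

Import GRing.Theory.
Local Open Scope ring_scope.

(** Write R = S^(d), T = M (x)_R M' and phi for the multiplication map T -> M''.

    The tensors X^u (x) X^v of monomials span T over k, and a monomial whose degree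
    is a multiple of d can cross the tensor sign. If the degree of X^u (x) X^v
    exceeds r + r', some degree d is in excess on one side. That is room enough to
    trade a variable a on the left for a variable b on the right: b goes across
    together with a monomial c of degree d - 1, and a comes back together with c.
    So in degrees > r + r' a tensor of monomials only depends on the product of its
    two factors (tmon_exchange), and phi is injective there. In degree r + r' no
    scalar of positive degree is available: lowtens and lowpart identify that part
    of T with S_r' (x)_k S_r, the tensor product of the two rows of the ribbon. The
    kernel of the multiplication there is spanned by the differences
    x a (x) y b - x b (x) y a, again because any two factorizations of a monomial
    are joined by trades of variables (mnm_exchange_ind). These differences are the
    antisymmetrizations of the corner column of the ribbon, the only column with
    more than one cell (schur_map_wedge). So the kernel is the Schur functor.

    The splitting over R comes from the section monsec of phi that sends each
    monomial to a chosen factorization. It is k-linear by construction. It is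
    R-linear since monsec(phi(f t)) = f t for f in R_+ (monsec_phi_Rplus), a form of
    the injectivity of phi on R_+ T. The complementary projection is
    t |-> t - monsec(phi t), which lives in degree r + r'.

    For the last part, the polarization v_1 ... v_N |-> sum over subsets A of
    v_A (x) v_(complement of A) is equivariant, and phi sends it to binomial
    (r + r', r) times the product in degree r + r' and to 0 in the other degrees
    (phi_polarX). If the binomial coefficient is invertible, a multiple of it
    replaces monsec in degree r + r'. In higher degrees monsec is already
    equivariant, as phi is injective and equivariant (monsec_gl_Rplus). *)

(** * Exchanging variables between monomials *)

Section Multinomials.
Variable n : nat.
Implicit Types u v w m : 'X_{1..n}.

Lemma lem_addP u m : reflect (exists w, m = (u + w)%MM) (u <= m)%MM.
Proof.
apply: (iffP idP) => [/submK <-|[w ->]]; last exact: lem_addr.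
by exists (m - u)%MM; rewrite addmC.
Qed.

Lemma mdeg_subm u m : (u <= m)%MM -> mdeg (m - u)%MM = (mdeg m - mdeg u)%N.
Proof. by move=> /submK {2}<-; rewrite mdegD addnK. Qed.

(** A divisor of degree j, obtained by listing the variables of m with multiplicity
    and keeping the first j of them. *)
Definition mnmtake j m : 'X_{1..n} := s2m (take j (m2s m)).

Lemma mnmtake_le j m : (mnmtake j m <= m)%MM.
Proof.
apply/mnm_lepP => i; rewrite -[m in X in (_ <= X)%N]s2mK !mnmE.
by rewrite -[in X in (_ <= X)%N](cat_take_drop j (m2s m)) count_cat leq_addr.
Qed.

Lemma mdeg_s2m (l : seq 'I_n) : mdeg (s2m l) = size l.
Proof.
rewrite mdegE; under eq_bigr do rewrite mnmE.
elim: l => [|i l IH] /=; first by rewrite big1.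
rewrite big_split /= IH (bigD1 i) //= eqxx big1 // => j ji.
by rewrite eq_sym (negPf ji).
Qed.

Lemma mdeg_mnmtake j m : (j <= mdeg m)%N -> mdeg (mnmtake j m) = j.
Proof. by move=> jm; rewrite mdeg_s2m size_takel // size_m2s. Qed.

Lemma mnmtakeK j m : (mnmtake j m + (m - mnmtake j m) = m)%MM.
Proof. by rewrite addmC submK // mnmtake_le. Qed.

(** Two divisors of m of the same degree are joined by a chain of divisors of m in
    which each step trades one variable for another: a variable in excess in u is
    replaced by one in excess in v, which decreases the degree of the truncated
    difference u - v. So a preorder on divisors only has to be checked on trades. *)
Lemma mnm_exchange_ind (Q : 'X_{1..n} -> 'X_{1..n} -> Prop) r m :
  (forall u, Q u u) -> (forall u v w, Q u v -> Q v w -> Q u w) ->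
  (forall u i j, mdeg u = r -> (u + U_(i) + U_(j) <= m)%MM ->
     Q (u + U_(i))%MM (u + U_(j))%MM) ->
  forall u v, (u <= m)%MM -> (v <= m)%MM -> mdeg u = r.+1 -> mdeg v = r.+1 ->
  Q u v.
Proof.
move=> Q0 QT QE u v um vm du dv.
move: {2}(mdeg _) (leqnn (mdeg (u - v)%MM)) => N.
elim: N u um du => [|N IH] u um du duv.
  suff -> : u = v by [].
  have /lem_addP[w e] : (u <= v)%MM.
    apply/mnm_lepP => i; have: mdeg (u - v)%MM == 0%N by rewrite -leqn0.
    rewrite mdeg_eq0 => /eqP /mnmP /(_ i); rewrite mnmBE mnm0E => /eqP.
    by rewrite subn_eq0.
  move: dv; rewrite e mdegD du => /eqP; rewrite -[X in _ == X]addn0 eqn_add2l.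
  by rewrite mdeg_eq0 => /eqP ->; rewrite addm0.
case: (eqVneq u v) => [-> //|uv].
have [i hi] : exists i, (v i < u i)%N.
  case: (pickP (fun i => v i < u i)%N) => [i hi|h]; first by exists i.
  have /lem_addP[w e] : (u <= v)%MM by apply/mnm_lepP => i; rewrite leqNgt h.
  move: dv uv; rewrite e mdegD du => /eqP; rewrite -[X in _ == X]addn0 eqn_add2l.
  by rewrite mdeg_eq0 => /eqP ->; rewrite addm0 eqxx.
have [j hj] : exists j, (u j < v j)%N.
  case: (pickP (fun i => u i < v i)%N) => [j hj|h]; first by exists j.
  have /lem_addP[w e] : (v <= u)%MM by apply/mnm_lepP => l; rewrite leqNgt h.
  move: du uv; rewrite e mdegD dv => /eqP; rewrite -[X in _ == X]addn0 eqn_add2l.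
  by rewrite mdeg_eq0 => /eqP ->; rewrite addm0 eqxx.
have ui : (U_(i) <= u)%MM by rewrite lep1mP; lia.
have ij : i != j by apply: contraTneq hj => <-; lia.
pose u0 := (u - U_(i))%MM.
have eu : u = (u0 + U_(i))%MM by rewrite submK.
have du0 : mdeg u0 = r by rewrite mdeg_subm // du mdeg1 subn1.
have le : (u0 + U_(i) + U_(j) <= m)%MM.
  rewrite -eu; apply/mnm_lepP => l; rewrite mnmDE mnm1E.
  by have := mnm_lepP um l; have := mnm_lepP vm l; case: eqP => [<-|_] /=; lia.
rewrite eu; apply: QT (QE u0 i j du0 le) _; apply: IH.
- apply: lepm_trans le; apply/mnm_lepP => l; rewrite !mnmDE; lia.
- by rewrite mdegD mdeg1 du0 addn1.
rewrite -ltnS; apply: leq_trans duv.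
rewrite !mdegE (bigD1 i) //= [X in (_ < X)%N](bigD1 i) //=.
rewrite -addSn leq_add //.
  rewrite !mnmE eqxx [j == i]eq_sym (negPf ij) /=; lia.
apply: leq_sum => l li; rewrite !mnmE eq_sym (negPf li).
by case: eqP => [<-|_] /=; lia.
Qed.

Lemma mpolyX_factors (k : comNzRingType) N m : mdeg m = N ->
  exists f : 'I_N -> 'I_n, 'X_[k, m] = \prod_b 'X_(f b).
Proof.
move=> dm; have sz : size (m2s m) == N by rewrite size_m2s dm.
exists (tnth (Tuple sz)).
rewrite mprodXE -[m in LHS]s2mK; congr 'X_[_].
have -> : (\big[+%MM/0%MM]_(b < N) U_(tnth (Tuple sz) b) =
          \big[+%MM/0%MM]_(i <- m2s m) U_(i))%MM.
  by rewrite [RHS](big_tuple _ _ (Tuple sz)).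
elim: (m2s m) => [|i l IH]; first by rewrite big_nil; apply/mnmP => i; rewrite !mnmE.
by rewrite big_cons -IH; apply/mnmP => j; rewrite !mnmE /= eq_sym.
Qed.
End Multinomials.

(** * Monomials in the Veronese modules and in their tensor product *)

Section MonomialExtension.
Variables (R : nzRingType) (n : nat) (K : nzRingType) (N : lmodType K).
Variable F : 'X_{1..n} -> R -> N.

(** Extension from monomials by an arbitrary additive family F m of maps on
    coefficients. Semilinearity is left as a hypothesis because the extension is
    used both over k and, for polynomials with coefficients in S, over the constants
    a%:MP only. *)
Definition mon_ext (p : {mpoly R[n]}) : N := \sum_(m <- msupp p) F m p@_m.

Hypothesis F0 : forall m, F m 0 = 0.

Lemma mon_ext_widenE k p : (msize p <= k)%N -> mon_ext p = \sum_(m : 'X_{1..n < k}) F m p@_m.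
Proof.
move=> lt_pk; rewrite /mon_ext (big_mksub 'X_{1..n < k}) //=; first last.
- by move=> m /msize_mdeg_lt /leq_trans; apply.
- by rewrite msupp_uniq.
by rewrite big_rmcond //= => i /memN_msupp_eq0 ->.
Qed.

Lemma mon_ext_semilinear (a : R) (b : K) :
  (forall m x y, F m (a * x + y) = b *: F m x + F m y) ->
  forall p q, mon_ext (a *: p + q) = b *: mon_ext p + mon_ext q.
Proof.
move=> FP p q.
pose l := maxn (msize (a *: p + q)) (maxn (msize p) (msize q)).
rewrite !(@mon_ext_widenE l) /l ?leq_max ?leqnn ?orbT // scaler_sumr -big_split /=.
by apply: eq_bigr => m _; rewrite mcoeffD mcoeffZ FP.
Qed.

Lemma mon_ext_monomial (c : R) m : mon_ext (c *: 'X_[m]) = F m c.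
Proof.
rewrite (mon_ext_widenE (leqnn _)).
case: (eqVneq c 0) => [->|c0].
  by rewrite F0 big1 // => i _; rewrite mcoeffZ mul0r F0.
have hm : (mdeg m < msize (c *: 'X_[R, m]))%N.
  apply: msize_mdeg_lt; rewrite mcoeff_msupp mcoeffZ mcoeffX eqxx mulr1 //.
rewrite (bigD1 (BMultinom hm)) //= mcoeffZ mcoeffX eqxx mulr1 big1 ?addr0 //.
move=> i; rewrite -val_eqE /= => im.
by rewrite mcoeffZ mcoeffX eq_sym (negPf im) mulr0 F0.
Qed.

End MonomialExtension.

Definition linear_of (A : nzRingType) (U V : lmodType A) (f : U -> V)
    (fP : linear f) : {linear U -> V} :=
  HB.pack f (GRing.isLinear.Build A U V _ f fP).

Section TensorArithmetic.
Variables (A : comNzRingType) (M N : lmodType A).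
Implicit Types (x : M) (y : N).

Lemma tmul0l y : tmul (0 : M) y = 0.
Proof.
by have := tmulPl (-1) (0 : M) 0 y; rewrite scaler0 addr0 scaleN1r addNr.
Qed.

Lemma tmul0r x : tmul x (0 : N) = 0.
Proof.
by have := tmulPr (-1) x (0 : N) 0; rewrite scaler0 addr0 scaleN1r addNr.
Qed.

Lemma tmulZl a x y : tmul (a *: x) y = a *: tmul x y.
Proof. by have := tmulPl a x 0 y; rewrite addr0 tmul0l addr0. Qed.

Lemma tmulZr a x y : tmul x (a *: y) = a *: tmul x y.
Proof. by have := tmulPr a x y 0; rewrite addr0 tmul0r addr0. Qed.
End TensorArithmetic.

Section VeroneseMonomials.
Variables (k : comUnitRingType) (n d : nat).
Local Notation S := {mpoly k[n]}.
Local Notation R := (veronese k n d).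

(** The degrees that occur in S^(>= r, d). *)
Definition vermod_deg r j := (r <= j)%N && (j == r %[mod d])%N.

Lemma vermod_deg_refl r : vermod_deg r r.
Proof. by rewrite /vermod_deg leqnn eqxx. Qed.

Lemma vermod_degDl r i j : (d %| i)%N -> vermod_deg r j -> vermod_deg r (i + j)%N.
Proof.
move=> di /andP[rj /eqP e]; rewrite /vermod_deg (leq_trans rj) ?leq_addl //=.
by rewrite -modnDml (eqP di) add0n e.
Qed.

Lemma vermod_degP r j : reflect (exists i, j = (i * d + r)%N) (vermod_deg r j).
Proof.
apply: (iffP andP) => [[rj]|[i ->]].
  rewrite eqn_mod_dvd // => /dvdnP[i e]; exists i; rewrite -e; lia.
by rewrite leq_addl modnMDl.
Qed.

Lemma vermod_degD r r' i j : vermod_deg r i -> vermod_deg r' j -> vermod_deg (r + r') (i + j)%N.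
Proof. move=> /vermod_degP[a ->] /vermod_degP[b ->]; apply/vermod_degP; exists (a + b)%N; lia. Qed.

(** The monomial as an element of S^(>= r, d), with the default value 0 in the
    degrees that do not occur there; rmon below does the same for S^(d). *)
Definition vmon r u : vermod k n d r := insubd 0 'X_[u].

Lemma degsX P u : (('X_[u] : S) \in degs P) = P (mdeg u).
Proof. by rewrite /degs unfold_in /= msuppX /= andbT. Qed.

Lemma vmonE r u : vermod_deg r (mdeg u) -> val (vmon r u) = 'X_[u].
Proof. by move=> h; rewrite insubdK // degsX. Qed.

Lemma vmon0 r u : ~~ vermod_deg r (mdeg u) -> vmon r u = 0.
Proof. by move=> h; rewrite /vmon /insubd insubN // degsX. Qed.

Definition rmon e : R := insubd 0 'X_[e].

Lemma rmonE e : (d %| mdeg e)%N -> val (rmon e) = 'X_[e].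
Proof. by move=> h; rewrite insubdK // degsX. Qed.

Lemma rmon_vmon r e u : (d %| mdeg e)%N -> vermod_deg r (mdeg u) ->
  rmon e *: vmon r u = vmon r (e + u).
Proof.
move=> he hu; apply: val_inj => /=.
by rewrite rmonE // !vmonE ?mdegD ?vermod_degDl // mpolyXD.
Qed.

Local Notation Rc := (verC n d).

Lemma verC_is_zmod_morphism : zmod_morphism (Rc : k -> R).
Proof. by move=> a b; apply: val_inj; rewrite /= mpolyCB. Qed.
Lemma verC_is_monoid_morphism : monoid_morphism (Rc : k -> R).
Proof. by split=> [|a b]; apply: val_inj => //=; rewrite mpolyCM. Qed.
HB.instance Definition _ :=
  GRing.isZmodMorphism.Build k R Rc verC_is_zmod_morphism.
HB.instance Definition _ :=
  GRing.isMonoidMorphism.Build k R Rc verC_is_monoid_morphism.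

Lemma val_verCZ r a (x : vermod k n d r) : val (Rc a *: x) = a *: val x.
Proof. by rewrite /= mul_mpolyC. Qed.

Lemma val_verCP r a (x y : vermod k n d r) : val (Rc a *: x + y) = a *: val x + val y.
Proof. by rewrite -val_verCZ. Qed.

Lemma val_sum r I (s : seq I) (F : I -> vermod k n d r) :
  val (\sum_(i <- s) F i) = \sum_(i <- s) val (F i).
Proof. exact: raddf_sum. Qed.

Lemma vermod_msupp r (x : vermod k n d r) u : u \in msupp (val x) -> vermod_deg r (mdeg u).
Proof. exact: (degsP _ _ (valP x)). Qed.

Lemma vermod_monE r (x : vermod k n d r) :
  x = \sum_(u <- msupp (val x)) Rc (val x)@_u *: vmon r u.
Proof.
apply: val_inj; rewrite val_sum [LHS]mpolyE big_seq [RHS]big_seq.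
by apply: eq_bigr => u hu; rewrite val_verCZ vmonE // (vermod_msupp hu).
Qed.

Lemma vermod_ind r (P : vermod k n d r -> Prop) :
  P 0 -> (forall a x y, P x -> P y -> P (Rc a *: x + y)) ->
  (forall u, vermod_deg r (mdeg u) -> P (vmon r u)) -> forall x, P x.
Proof.
move=> P0 PD PX x; rewrite (vermod_monE x) big_seq.
by elim/big_ind: _ => [//|y z Py Pz|u hu];
  [rewrite -[y]scale1r -(rmorph1 Rc); apply: PD
  |rewrite -[_ *: _]addr0; apply: (PD) => //; apply: PX; exact: vermod_msupp hu].
Qed.

Lemma ver_msupp (f : R) u : u \in msupp (val f) -> (d %| mdeg u)%N.
Proof. exact: (degsP _ _ (valP f)). Qed.

Lemma ver_monE (f : R) :
  f = \sum_(u <- msupp (val f)) Rc (val f)@_u * rmon u.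
Proof.
apply: val_inj; rewrite [RHS](raddf_sum (val : R -> S)) [LHS]mpolyE big_seq [RHS]big_seq.
by apply: eq_bigr => u hu; rewrite /= rmonE ?mul_mpolyC // (ver_msupp hu).
Qed.

(** Maps are compared on monomials, or on tensors of monomials, for which k-linearity
    is enough; so the group actions, which are only semilinear over S^(d), and the
    section are treated in the same way as the R-linear maps. *)
Lemma k_linear_lin (A B : lmodType R) (f : {linear A -> B}) : k_linear f.
Proof. by move=> a x y; exact: linearP. Qed.

Lemma k_linear_comp (A B C : lmodType R) (f : B -> C) (g : A -> B) :
  k_linear f -> k_linear g -> k_linear (f \o g).
Proof. by move=> fP gP a x y /=; rewrite gP fP. Qed.

Lemma k_linear_zmod (A B : lmodType R) (f : A -> B) : k_linear f -> zmod_morphism f.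
Proof.
move=> fP x y; have := fP (-1) y x.
by rewrite rmorphN rmorph1 !scaleN1r addrC => ->; rewrite addrC.
Qed.

Lemma k_linear0 (A B : lmodType R) (f : A -> B) : k_linear f -> f 0 = 0.
Proof. by move=> /k_linear_zmod fB; rewrite -(subrr 0) fB subrr. Qed.

Lemma k_linearZ (A B : lmodType R) (f : A -> B) a x : k_linear f ->
  f (Rc a *: x) = Rc a *: f x.
Proof. by move=> fP; have := fP a x 0; rewrite (k_linear0 fP) !addr0. Qed.

Lemma k_linear_sum (A B : lmodType R) (f : A -> B) I (s : seq I) (F : I -> A) :
  k_linear f -> f (\sum_(i <- s) F i) = \sum_(i <- s) f (F i).
Proof.
move=> fP; elim: s => [|i s IH]; first by rewrite !big_nil (k_linear0 fP).
by have := fP 1 (F i) (\sum_(i <- s) F i); rewrite !big_cons rmorph1 !scale1r IH.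
Qed.

Lemma vermod_eq r (N : lmodType R) (f g : vermod k n d r -> N) :
  k_linear f -> k_linear g ->
  (forall u, vermod_deg r (mdeg u) -> f (vmon r u) = g (vmon r u)) -> f =1 g.
Proof.
move=> fP gP e; elim/vermod_ind => [|a x y ex ey|//]; first by rewrite (k_linear0 fP) (k_linear0 gP).
by rewrite fP gP ex ey.
Qed.

Variables r r' : nat.
Local Notation M := (vermod k n d r).
Local Notation M' := (vermod k n d r').
Local Notation T := (tens M M').

Definition tmon u v : T := tmul (vmon r u) (vmon r' v).

Lemma tmon_ind (P : T -> Prop) :
  P 0 -> (forall a t t', P t -> P t' -> P (Rc a *: t + t')) ->
  (forall u v, vermod_deg r (mdeg u) -> vermod_deg r' (mdeg v) -> P (tmon u v)) ->
  forall t, P t.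
Proof.
move=> P0 PD PX; elim/tens_ind => [//|f x y z Pz].
have PA t t' : P t -> P t' -> P (t + t').
  by move=> Pt Pt'; rewrite -[t]scale1r -(rmorph1 Rc); apply: PD.
apply: PA Pz; rewrite -tmulZl; move: (f *: x) => {}x.
elim/vermod_ind: x y => [y|a x x' Px Px' y|u hu y].
- by rewrite tmul0l.
- by rewrite tmulPl; apply: PD.
elim/vermod_ind: y => [|a y y' Py Py'|v hv].
- by rewrite tmul0r.
- by rewrite tmulPr; apply: PD.
exact: PX.
Qed.

Lemma tmon_eq (N : lmodType R) (f g : T -> N) : k_linear f -> k_linear g ->
  (forall u v, vermod_deg r (mdeg u) -> vermod_deg r' (mdeg v) -> f (tmon u v) = g (tmon u v)) ->
  f =1 g.
Proof.
move=> fP gP e; elim/tmon_ind => [|a x y ex ey|//]; first by rewrite (k_linear0 fP) (k_linear0 gP).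
by rewrite fP gP ex ey.
Qed.

(** A monomial of S^(d) crosses the tensor sign: all relations between tensors of
    monomials used below come from this one. *)
Lemma tmon_shift e u v : (d %| mdeg e)%N -> vermod_deg r (mdeg u) -> vermod_deg r' (mdeg v) ->
  tmon (e + u) v = tmon u (e + v).
Proof. by move=> he hu hv; rewrite /tmon -!rmon_vmon // tmulZl tmulZr. Qed.

Lemma rmon_tmon e u v : (d %| mdeg e)%N -> vermod_deg r (mdeg u) -> vermod_deg r' (mdeg v) ->
  rmon e *: tmon u v = tmon (e + u) v.
Proof. by move=> he hu hv; rewrite /tmon -tmulZl rmon_vmon. Qed.

Hypotheses (hd : (0 < d)%N) (hr : (0 < r)%N).

(** In degree > r + r' there is a monomial c of degree d - 1 to spare in the second
    factor. To trade a for b, send b c across, and send a c back: both have degree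
    d, so both moves are multiplications by elements of S^(d). *)
Lemma tmon_exchange u u' m : mdeg u = r -> mdeg u' = r ->
  (u <= m)%MM -> (u' <= m)%MM ->
  vermod_deg (r + r') (mdeg m) -> (r + r' < mdeg m)%N ->
  tmon u (m - u) = tmon u' (m - u').
Proof.
move=> du du' um um' /vermod_degP[i dm] gt.
pose Q u u' := tmon u (m - u) = tmon u' (m - u').
apply: (mnm_exchange_ind (Q := Q) (r := r.-1) (m := m)) => //; try by rewrite prednK.
  by move=> u1 u2 u3; rewrite /Q => -> .
move=> {um um' du du'} {}u a b du le; rewrite /Q.
have {}dm : (d.-1 + 1 + (mdeg u + 1) + (r' + i.-1 * d) = mdeg m)%N.
  by rewrite du dm; case: i dm gt => [|i] /= -> ?; rewrite ?mulSn; lia.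
have [v em] := lem_addP _ _ le.
have dv : mdeg v = (d.-1 + (r' + i.-1 * d))%N.
  by move: dm; rewrite em !mdegD !mdeg1; lia.
(* m = u a b c w, where w is left with a degree of S^(>= r', d). *)
pose c := mnmtake d.-1 v; pose w := (v - c)%MM.
have ev : v = (c + w)%MM by rewrite mnmtakeK.
have dc : mdeg c = d.-1 by rewrite mdeg_mnmtake // dv leq_addr.
have dw : vermod_deg r' (mdeg w).
  by apply/vermod_degP; exists i.-1; move: dv; rewrite ev mdegD dc; lia.
have di (j : 'I_n) : (d %| mdeg (U_(j) + c)%MM)%N.
  by rewrite mdegD mdeg1 dc add1n prednK.
have vr (j : 'I_n) : vermod_deg r (mdeg (u + U_(j))%MM).
  by rewrite mdegD mdeg1 du addn1 prednK // vermod_deg_refl.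
have -> : (m - (u + U_(a)) = U_(b) + c + w)%MM.
  by rewrite em ev; apply/mnmP => j; rewrite !mnmE; lia.
have -> : (m - (u + U_(b)) = U_(a) + c + w)%MM.
  by rewrite em ev; apply/mnmP => j; rewrite !mnmE; lia.
rewrite -!tmon_shift //; congr tmon.
by apply/mnmP => j; rewrite !mnmE; lia.
Qed.
End VeroneseMonomials.

(** * The monomial section of the multiplication map *)

Section MonomialSection.
Variables (k : comUnitRingType) (n d r r' : nat).
Local Notation S := {mpoly k[n]}.
Local Notation R := (veronese k n d).
Local Notation M := (vermod k n d r).
Local Notation M' := (vermod k n d r').
Local Notation M'' := (vermod k n d (r + r')).
Local Notation T := (tens M M').
Local Notation Rc := (verC n d).
Local Notation tmon := (@tmon k n d r r').
Local Notation vmon := (@vmon k n d).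
Local Notation phi := (mult_map k n d r r').

Lemma phiE x y : phi (tmul x y) = vermul x y.
Proof. exact: tliftE. Qed.

Lemma phi_tmon (u v : 'X_{1..n}) : vermod_deg d r (mdeg u) -> vermod_deg d r' (mdeg v) ->
  phi (tmon u v) = vmon (r + r') (u + v).
Proof.
move=> hu hv; rewrite phiE; apply: val_inj => /=.
by rewrite !vmonE ?mdegD ?vermod_degD // mpolyXD.
Qed.

Definition splitmon (m : 'X_{1..n}) : T := tmon (mnmtake r m) (m - mnmtake r m).

(** The section that sends each monomial to its chosen factorization. This choice
    depends on the basis x_1, ..., x_n, so equivariance cannot be expected in the
    lowest degree. *)
Definition monsec (x : M'') : T := mon_ext (fun m c => Rc c *: splitmon m) (val x).

Lemma monsec_k_linear : k_linear monsec.
Proof.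
move=> a x y; rewrite /monsec -(mon_ext_semilinear _ (a := a)) => [|m|m b c].
- by rewrite raddfD /= -mul_mpolyC.
- by rewrite rmorph0 scale0r.
- by rewrite rmorphD rmorphM scalerDl scalerA.
Qed.

Lemma monsec_vmon (m : 'X_{1..n}) : vermod_deg d (r + r') (mdeg m) -> monsec (vmon (r + r') m) = splitmon m.
Proof.
move=> hm; rewrite /monsec vmonE // -['X_[m]]scale1r mon_ext_monomial ?rmorph1 ?scale1r //.
by move=> u; rewrite rmorph0 scale0r.
Qed.

Lemma vermod_deg_take (m : 'X_{1..n}) : vermod_deg d (r + r') (mdeg m) ->
  mdeg (mnmtake r m) = r /\ vermod_deg d r' (mdeg (m - mnmtake r m)%MM).
Proof.
move=> /vermod_degP[i dm]; rewrite mdeg_subm ?mnmtake_le // mdeg_mnmtake; last by rewrite dm; lia.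
by split=> //; apply/vermod_degP; exists i; lia.
Qed.

Lemma monsecK : cancel monsec phi.
Proof.
have phis := k_linear_comp (k_linear_lin phi) monsec_k_linear.
apply: (vermod_eq (g := id) phis) => // m hm; rewrite /comp.
have [hu hv] := vermod_deg_take hm.
by rewrite monsec_vmon // phi_tmon ?hu ?vermod_deg_refl // mnmtakeK.
Qed.

Hypotheses (hd : (0 < d)%N) (hr : (0 < r)%N).

(** Above degree r + r' the chosen factorization is immaterial: first all of the
    excess degree of u is moved to the right, which leaves degree r on the left,
    and then tmon_exchange applies. *)
Lemma tmon_splitmon (u v : 'X_{1..n}) : vermod_deg d r (mdeg u) -> vermod_deg d r' (mdeg v) ->
  (r + r' < mdeg u + mdeg v)%N -> tmon u v = splitmon (u + v).
Proof.
move=> hu hv gt; have /vermod_degP[i du] := hu.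
pose u0 := mnmtake r u; pose e := (u - u0)%MM.
have ru : (r <= mdeg u)%N by rewrite du leq_addl.
have du0 : mdeg u0 = r by rewrite mdeg_mnmtake.
have de : mdeg e = (i * d)%N by rewrite mdeg_subm ?mnmtake_le // du0 du addnK.
have eu : u = (e + u0)%MM by rewrite addmC mnmtakeK.
rewrite {1}eu tmon_shift ?de ?dvdn_mull ?du0 ?vermod_deg_refl //.
have -> : (e + v = u + v - u0)%MM.
  by rewrite eu; apply/mnmP => j; rewrite !mnmE; lia.
have hm : vermod_deg d (r + r') (mdeg (u + v)%MM) by rewrite mdegD vermod_degD.
have [dm0 _] := vermod_deg_take hm.
have u0m : (u0 <= u + v)%MM by exact: lepm_trans (mnmtake_le _ _) (lem_addr _ _).
rewrite -mdegD in gt.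
exact: (tmon_exchange _ hd hr du0 dm0 u0m (mnmtake_le _ _) hm gt).
Qed.

Lemma monsec_phi_tmon (u v : 'X_{1..n}) : vermod_deg d r (mdeg u) -> vermod_deg d r' (mdeg v) ->
  (r + r' < mdeg u + mdeg v)%N -> monsec (phi (tmon u v)) = tmon u v.
Proof.
by move=> hu hv gt; rewrite phi_tmon // monsec_vmon ?mdegD ?vermod_degD // tmon_splitmon.
Qed.

(** Multiplying by R_+ leads into degrees > r + r', where a tensor of monomials is
    determined by its product. Hence phi is injective on R_+ T. This one identity
    gives the R-linearity of the section, that of the inclusion of the kernel, and
    the equivariance of the section in high degrees. *)
Lemma monsec_phi_Rplus (f : R) t : val f \in vermod_pred d d ->
  monsec (phi (f *: t)) = f *: t.
Proof.
move=> /degsP hf; have sphi := k_linear_comp monsec_k_linear (k_linear_lin phi).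
have monE e : e \in msupp (val f) ->
    monsec \o phi \o (fun t => rmon k d e *: t) =1 (fun t => rmon k d e *: t).
  move=> he; have /andP[de _] := hf e he; have ve := ver_msupp he.
  have scl : k_linear (fun t : T => rmon k d e *: t).
    by move=> a x y; rewrite scalerDr !scalerA mulrC.
  apply: (tmon_eq (k_linear_comp sphi scl) scl) => u v hu hv.
  rewrite /comp rmon_tmon // monsec_phi_tmon // ?mdegD ?vermod_degDl //.
  have /vermod_degP[? ->] := hu; have /vermod_degP[? ->] := hv; lia.
rewrite (ver_monE f) scaler_suml (k_linear_sum _ _ (k_linear_lin phi)).
rewrite (k_linear_sum _ _ monsec_k_linear) big_seq [RHS]big_seq.
apply: eq_bigr => e he; rewrite -scalerA.
rewrite (k_linearZ _ _ (k_linear_lin phi)) (k_linearZ _ _ monsec_k_linear).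
by congr (_ *: _); exact: monE.
Qed.

Lemma ver_split (f : R) : exists2 f', val f' \in vermod_pred d d &
  f = Rc (val f)@_0%MM + f'.
Proof.
exists (f - Rc (val f)@_0%MM); last by rewrite addrC subrK.
apply/degsP => m hm.
have dm := ver_msupp hm.
have m0 : (0 < mdeg m)%N.
  rewrite lt0n mdeg_eq0; apply: contraTneq hm => ->.
  by rewrite mcoeff_msupp /= mcoeffB mcoeffC eqxx mulr1 subrr negbK.
by rewrite (dvdn_leq m0 dm) eqn_mod_dvd ?dvdn_sub // (dvdn_leq m0 dm).
Qed.

(** Constants are harmless by k-linearity. For f in R_+, both f monsec(x) and
    monsec(f x) equal monsec(phi(f monsec(x))). *)
Lemma monsec_linear : linear monsec.
Proof.
have sD : zmod_morphism monsec by exact: k_linear_zmod monsec_k_linear.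
suff secS f x : monsec (f *: x) = f *: monsec x.
  move=> f x y; rewrite -secS; move: (f *: x) => z.
  by have := monsec_k_linear 1 z y; rewrite rmorph1 !scale1r.
have [f' hf' ->] := ver_split f.
have := monsec_k_linear (val f)@_0%MM x (f' *: x); rewrite !scalerDl => ->; congr (_ + _).
by rewrite -[x in LHS]monsecK -linearZ_LR monsec_phi_Rplus.
Qed.
End MonomialSection.

(** * The Schur functor of the ribbon *)

Section SmallAntisym.
Variables (A : comNzRingType) (V : lmodType A) (l : nat).
Implicit Type v : 'I_l -> V.

Lemma antisym_wedge1 v : (l <= 1)%N -> antisym V l (wedge v) = mtmul v.
Proof.
move=> l1; have ord_eq (a b : 'I_l) : a = b.
  by apply: val_inj; have := ltn_ord a; have := ltn_ord b; rewrite /=; lia.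
have one (w : 'S_l) : w = 1%g by apply/permP => a; apply: ord_eq.
rewrite antisymE (big_pred1 1%g) => [|w]; last by rewrite [w]one [X in pred1 X]one /= eqxx.
rewrite odd_perm1 expr0 scale1r; congr mtmul.
by apply: functional_extensionality_dep => a; rewrite perm1.
Qed.

Lemma antisym_wedge2 v (i j : 'I_l) : l = 2%N -> i != j ->
  antisym V l (wedge v) = mtmul v - mtmul (fun a => v (tperm i j a)).
Proof.
move=> l2 ij; have ij_all a : (a == i) || (a == j).
  have /setP/(_ a) : [set i; j] = [set: 'I_l].
    by apply/eqP; rewrite eqEcard subsetT cardsT card_ord cards2 ij l2.
  by rewrite !inE.
have two (w : 'S_l) : (w == 1%g) || (w == tperm i j).
  have wji : w j != w i by rewrite (inj_eq perm_inj) eq_sym.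
  apply/orP; case/orP: (ij_all (w i)) (ij_all (w j)) => /eqP wi; rewrite wi in wji *.
    rewrite (negPf wji) /= => /eqP wj; left; apply/eqP/permP => a; rewrite perm1.
    by case/orP: (ij_all a) => /eqP ->.
  rewrite (negPf wji) orbF => /eqP wj; right; apply/eqP/permP => a.
  by case/orP: (ij_all a) => /eqP ->; rewrite (tpermL, tpermR).
have t1 : tperm i j != 1%g.
  by apply: contraNneq ij => e; rewrite -[X in X == _](perm1 i) -e tpermL eqxx.
rewrite antisymE (bigD1 1%g) //= (bigD1 (tperm i j)) //= big1 => [|w]; last first.
  by case/andP=> w1 wt; have := two w; rewrite (negPf w1) (negPf wt).
rewrite odd_perm1 expr0 scale1r odd_tperm ij expr1 scaleN1r addr0.
congr (mtmul _ - _).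
by apply: functional_extensionality_dep => a; rewrite perm1.
Qed.
End SmallAntisym.

Section Ribbon.
Variables (k : comNzRingType) (n r r' : nat).
Hypotheses (hr : (0 < r)%N) (hr' : (0 < r')%N).
Local Notation V := 'cV[k]_n.
Local Notation S := {mpoly k[n]}.
Local Notation N := (r + r').-1.
Local Notation D := (ribbon r r').
Local Notation symrows := (symrows k n D).

Lemma mem_ribbon i j : ((i, j) \in D) = if i == ord0 then (r.-1 <= j)%N else (j < r)%N.
Proof. by rewrite inE. Qed.

Lemma card_rowset i : #|rowset D i| = if i == ord0 then r' else r.
Proof.
have cardlt a : (a <= N)%N -> #|[set j : 'I_N | (j < a)%N]| = a.
  move=> aN; rewrite -sum1dep_card -(big_ord_widen N (fun=> 1%N)) //.
  by rewrite sum_nat_const card_ord muln1.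
case: ifP => i0.
  have -> : rowset D i = ~: [set j : 'I_N | (j < r.-1)%N].
    by apply/setP => j; rewrite !inE /= i0 leqNgt.
  apply/eqP; rewrite -(eqn_add2l r.-1) -{1}[r.-1]cardlt; last by lia.
  by rewrite cardsC card_ord; apply/eqP; lia.
have -> : rowset D i = [set j : 'I_N | (j < r)%N].
  by apply/setP => j; rewrite !inE /= i0.
by rewrite cardlt //; lia.
Qed.

Lemma corner_subproof : (r.-1 < N)%N.
Proof. lia. Qed.
Definition corner_col : 'I_N := Ordinal corner_subproof.

Lemma corner_mem i : (i, corner_col) \in D.
Proof. by rewrite mem_ribbon; case: ifP => //= _; rewrite prednK. Qed.
Definition corner i : cell D := exist _ (i, corner_col) (corner_mem i).

(** The corner column is the only one with two cells, so the column group of the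
    ribbon is generated by this transposition. *)
Definition corner_swap : {perm cell D} := tperm (corner ord0) (corner ord_max).

Lemma card_colset_out j : j != corner_col -> (#|colset D j| <= 1)%N.
Proof.
move=> jc; apply/card_le1_eqP => a b; rewrite !inE /=.
have {}jc : nat_of_ord j <> r.-1 by move=> e; case/eqP: jc; apply: val_inj.
by case: a b => [[|[|//]] ?] [[|[|//]] ?] //= ha hb; apply: val_inj => //=; lia.
Qed.

Lemma card_colset_corner : #|colset D corner_col| = 2%N.
Proof.
have -> : colset D corner_col = [set: 'I_2].
  by apply/setP => i; rewrite inE corner_mem inE.
by rewrite cardsT card_ord.
Qed.

Lemma colcell_inj j : injective (@colcell _ _ D j).
Proof. by move=> a b /(congr1 (fun x => (val x).1)) /enum_val_inj. Qed.

(** Antisymmetrizing the columns of a ribbon only concerns the corner, so the Schur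
    functor is spanned by the differences x a (x) y b - x b (x) y a. *)
Lemma schur_map_wedge (v : cell D -> V) :
  schur_map D (mtmul (fun j => wedge (fun a : 'I_#|colset D j| => v (colcell a)))) =
  mtmul (rowprod v) - mtmul (rowprod (v \o corner_swap)).
Proof.
have -> : schur_map D (mtmul (fun j => wedge (fun a => v (colcell a)))) =
    rowmul D (Defs.flatten D (mtmul (fun j =>
      antisym V #|colset D j| (wedge (fun a => v (colcell a)))))).
  by rewrite /schur_map /= mtmapE.
pose flat (w : cell D -> V) j : tpow V 'I_#|colset D j| :=
  mtmul (fun a : 'I_#|colset D j| => w (colcell a)).
rewrite -!rowmulE -(flattenE v) -(flattenE (v \o corner_swap)) addrC -scaleN1r.
rewrite -linearP -linearP; congr (rowmul D (Defs.flatten D _)).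
apply: (mtmul_mlin (i := corner_col)) => [|j jc|j jc].
- pose a0 := colrank (corner ord0); pose a1 := colrank (corner ord_max).
  have e0 : colcell a0 = corner ord0 by exact: colrankK.
  have e1 : colcell a1 = corner ord_max by exact: colrankK.
  have a01 : a0 != a1.
    by apply/eqP => /(congr1 (fun a => (val (colcell a)).1)); rewrite e0 e1.
  rewrite (antisym_wedge2 _ card_colset_corner a01) scaleN1r [RHS]addrC; congr (_ - mtmul _).
  apply: functional_extensionality_dep => a /=; congr v; rewrite /corner_swap.
  case: tpermP => [->|->|h0 h1]; rewrite ?e0 ?e1 ?tpermL ?tpermR //.
  by rewrite tpermD // -?e0 -?e1; apply/eqP => /colcell_inj e; [apply: h0|apply: h1].
- rewrite antisym_wedge1 ?card_colset_out //; congr mtmul.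
  apply: functional_extensionality_dep => a /=; rewrite tpermD //.
    by apply: contra jc => /eqP /(congr1 (fun x => (val x).2)) /= <-.
  by apply: contra jc => /eqP /(congr1 (fun x => (val x).2)) /= <-.
- by rewrite antisym_wedge1 ?card_colset_out.
Qed.

Lemma symmul_mlin :
  mlin (P := S) (fun y : forall i, dhomog n k #|rowset D i| => \prod_i val (y i)).
Proof.
move=> i a x x1 x2 xi e1 e2.
rewrite (bigD1 i) //= [X in _ = a *: X + _](bigD1 i) //= [X in _ = _ + X](bigD1 i) //=.
rewrite xi mulrDl -scalerAl.
by congr (_ *: (_ * _) + _ * _); apply: eq_bigr => j ji; [rewrite e1|rewrite e2].
Qed.
(** The product of the rows. Its value on a filling of the diagram does not change
    when cells are permuted, so it kills the Schur functor (symmul_schur_map). *)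
Definition symmul : {linear symrows -> S} := mtlift symmul_mlin.

Lemma symmulE y : symmul (mtmul y) = \prod_i val (y i).
Proof. exact: mtliftE. Qed.

Lemma symmul_rowprod v : symmul (mtmul (rowprod v)) = \prod_(x : cell D) linform (v x).
Proof.
rewrite symmulE /= sig_big_dep /=.
rewrite (reindex (fun x : cell D => Tagged (fun i => 'I_#|rowset D i|) (rowrank x))) /=.
  by apply: eq_bigr => x _; rewrite rowrankK.
exists (fun u => rowcell (tagged u)) => [x _|[j a] _] /=; first exact: rowrankK.
by rewrite -[in RHS](rowcellK a).
Qed.

Lemma symmul_schur_map t : symmul (schur_map D t) = 0.
Proof.
elim/mtens_ind: t => [|a x t IH]; first by rewrite !raddf0.
have gen (j : 'I_N) (y : ext V #|colset D j|) : spanned (fun e => exists v, e = wedge v) y.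
  elim/ext_ind: y => [P P0 //|b v z IHz P P0 PD PG].
  by apply: (PD); [apply: PG; exists v | exact: IHz].
rewrite linearP linearP IH addr0.
suff -> : symmul (schur_map D (mtmul x)) = 0 by rewrite scaler0.
apply: (mlin_eq gen (F := fun x => symmul (schur_map D (mtmul x))) (G := fun=> 0)).
- by move=> j b y y1 y2 ? ? ?; rewrite (@mtmul_mlin _ _ _ j b y y1 y2) // !linearP.
- by move=> *; rewrite scaler0 addr0.
move=> y /fin_all_exists [w hw].
pose v (u : cell D) := w (val u).2 (colrank u).
have -> : y = fun j => wedge (fun a : 'I_#|colset D j| => v (colcell a)).
  apply: functional_extensionality_dep => j; rewrite hw; congr wedge.
  by apply: functional_extensionality_dep => b; rewrite /v colcellK.
rewrite schur_map_wedge (linearB symmul) !symmul_rowprod /=.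
by rewrite (reindex_inj (@perm_inj _ corner_swap)) subrr.
Qed.

(** The bottom row (row 1) receives p and the top row (row 0) receives q, each one
    truncated to the length of its row so that p and q can be arbitrary. *)
Definition rowpair (p q : S) (i : 'I_2) : dhomog n k #|rowset D i| :=
  DHomog (pihomogP mdeg #|rowset D i| (if i == ord0 then q else p)).

Section Filling.
Variables (f : 'I_r.-1 -> 'I_n) (g : 'I_r'.-1 -> 'I_n).

(** A filling of the ribbon by variables: f in the bottom row left of the corner,
    g in the top row right of the corner, a and b in the two corner cells. Outside
    of the diagram the values default to a and b. *)
Definition fill_var (a b : 'I_n) (i : 'I_2) (m : nat) : 'I_n :=
  if i == ord0 then
    if m == r.-1 then b else oapp g b (insub (m - r)%N)
  else if m == r.-1 then a else oapp f a (insub m).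

Definition filling a b (x : cell D) : V :=
  cvbase k (fill_var a b (val x).1 (val x).2).

Lemma linform_cvbase i : linform (cvbase k i) = 'X_i :> S.
Proof.
rewrite /linform (bigD1 i) //= mxE !eqxx scale1r big1 ?addr0 // => j ji.
by rewrite mxE (negPf ji) scale0r.
Qed.

Lemma filling_swap a b : filling a b \o corner_swap = filling b a.
Proof.
apply: functional_extensionality_dep => x /=; rewrite /corner_swap /filling /fill_var.
case: tpermP => [->|->|h0 h1] /=; rewrite ?eqxx //.
case: x h0 h1 => [[i j] hx] /= h0 h1.
have jr : (j == r.-1 :> nat) = false.
  apply/eqP => e; have ej : j = corner_col by apply: val_inj.
  case: (eqVneq i ord0) => [ei|i0]; first by apply: h0; apply: val_inj; rewrite /= ei ej.
  apply: h1; apply: val_inj; rewrite /= ej; congr (_, _); apply: val_inj.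
  by case: (i) i0 => [[|[|]]].
rewrite jr; move: (hx); rewrite mem_ribbon.
case: ifP => _ hj; case: insubP => //=.
- move=> /negP; case; move: (ltn_ord j); move/eqP: jr; lia.
- move=> /negP; case; move/eqP: jr; lia.
Qed.

Lemma rowprod_filling a b :
  rowprod (filling a b) = rowpair (\prod_i 'X_(f i) * 'X_a) (\prod_i 'X_(g i) * 'X_b).
Proof.
have homX m (h : 'I_m -> 'I_n) : \prod_i ('X_(h i) : S) \is m.-homog.
  by apply: prod_homog => c; rewrite dhomogX /= mdeg1.
have homX1 m (h : 'I_m.-1 -> 'I_n) c : (0 < m)%N -> \prod_i ('X_(h i) : S) * 'X_c \is m.-homog.
  move=> m0; rewrite -[m in X in X.-homog]prednK // -addn1 dhomogM ?homX //.
  by rewrite dhomogX /= mdeg1.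
apply: functional_extensionality_dep => i; apply: val_inj => /=.
transitivity (\prod_(j in rowset D i) ('X_(fill_var a b i j) : S)).
  by rewrite [RHS]big_enum_val; apply: eq_bigr => c _; rewrite linform_cvbase.
under eq_bigl => j do rewrite inE mem_ribbon.
rewrite /fill_var; case: ifP => i0.
  rewrite pihomog_dE; last by rewrite card_rowset i0 homX1.
  rewrite -(big_geq_mkord _ _ predT (fun m => 'X_(if m == r.-1 then b else oapp g b (insub (m - r)%N)))).
  rewrite big_ltn ?corner_subproof // eqxx mulrC prednK //; congr (_ * _).
  rewrite -{1}[r]add0n big_addn big_mkord (_ : (N - r = r'.-1)%N); last by lia.
  apply: eq_bigr => j _; rewrite addnK valK ifN //=; lia.
rewrite pihomog_dE; last by rewrite card_rowset i0 homX1.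
rewrite -(big_ord_widen N (fun m => 'X_(if m == r.-1 then a else oapp f a (insub m)))); last by lia.
rewrite -(big_mkord predT (fun m => 'X_(if m == r.-1 then a else oapp f a (insub m)))).
rewrite -[r in X in \prod_(0 <= i < X) _](prednK hr) big_nat_recr //= eqxx big_mkord.
congr (_ * _); apply: eq_bigr => j _; rewrite valK ifN //=.
by rewrite neq_ltn ltn_ord.
Qed.
End Filling.

Lemma schur_exchange (u w : 'X_{1..n}) a b : mdeg u = r.-1 -> mdeg w = r'.-1 ->
  mtmul (rowpair 'X_[u + U_(a)] 'X_[w + U_(b)]) -
  mtmul (rowpair 'X_[u + U_(b)] 'X_[w + U_(a)]) \in @schur_pred k n _ _ D.
Proof.
move=> /(mpolyX_factors k)[f ef] /(mpolyX_factors k)[g eg].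
rewrite !mpolyXD ef eg -!rowprod_filling -(filling_swap f g a b).
by rewrite -schur_map_wedge; apply/asboolP; eexists.
Qed.

(** The differences of two factorizations of a monomial lie in the Schur functor,
    because a trade of variables is exactly what schur_map_wedge produces. Since
    these differences span the kernel of S_r (x) S_r' -> S_(r + r'), that kernel
    is the Schur functor. *)
Lemma schur_exchange_mon (u u' m : 'X_{1..n}) :
  mdeg m = (r + r')%N -> (u <= m)%MM -> (u' <= m)%MM -> mdeg u = r -> mdeg u' = r ->
  mtmul (rowpair 'X_[u] 'X_[m - u]) - mtmul (rowpair 'X_[u'] 'X_[m - u'])
    \in @schur_pred k n _ _ D.
Proof.
move=> dm um um' du du'; pose E u := mtmul (rowpair 'X_[u] 'X_[m - u]).
apply: (mnm_exchange_ind (Q := fun u u' => E u - E u' \in @schur_pred k n _ _ D)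
  (r := r.-1) (m := m)) => //; rewrite ?prednK //.
- by move=> v; rewrite subrr rpred0.
- by move=> u1 u2 u3 h1 h2; rewrite -(subrKA (E u2)) rpredD.
move=> {um um' du du'} {}u a b du le; rewrite /E.
have [w em] := lem_addP _ _ le.
have -> : (m - (u + U_(a)) = w + U_(b))%MM.
  by rewrite em; apply/mnmP => j; rewrite !mnmE; lia.
have -> : (m - (u + U_(b)) = w + U_(a))%MM.
  by rewrite em; apply/mnmP => j; rewrite !mnmE; lia.
apply: schur_exchange => //.
by move: dm; rewrite em !mdegD !mdeg1 du; lia.
Qed.

End Ribbon.

(** * The lowest-degree part of the tensor product *)

Section RestrictScalars.
Variables (k : comUnitRingType) (n d : nat) (N : lmodType (veronese k n d)).
(** Restriction of scalars from S^(d) to k. *)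
Definition krestr : Type := N.
HB.instance Definition _ := GRing.Zmodule.on krestr.
Definition kscale (a : k) (x : krestr) : krestr := verC n d a *: (x : N).
Fact kscaleA a b x : kscale a (kscale b x) = kscale (a * b) x.
Proof. by rewrite /kscale scalerA rmorphM. Qed.
Fact kscale1 : left_id 1 kscale.
Proof. by move=> x; rewrite /kscale rmorph1 scale1r. Qed.
Fact kscaleDr : right_distributive kscale +%R.
Proof. by move=> a x y; exact: scalerDr. Qed.
Fact kscaleDl x : {morph kscale^~ x : a b / a + b}.
Proof. by move=> a b; rewrite /kscale rmorphD; exact: scalerDl. Qed.
HB.instance Definition _ := GRing.Zmodule_isLmodule.Build k krestr
  kscaleA kscale1 kscaleDr kscaleDl.
End RestrictScalars.

Section LowDegree.
Variables (k : comUnitRingType) (n d r r' : nat).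
Local Notation S := {mpoly k[n]}.
Local Notation R := (veronese k n d).
Local Notation M := (vermod k n d r).
Local Notation M' := (vermod k n d r').
Local Notation T := (tens M M').
Local Notation Rc := (verC n d).
Local Notation tmon := (@tmon k n d r r').
Local Notation phi := (mult_map k n d r r').
Local Notation D := (ribbon r r').
Local Notation symrows := (symrows k n D).
Local Notation symmul := (@symmul k n r r').
Local Notation rowpair := (@rowpair k n r r').

Lemma pihomog_degs (P : pred nat) j (p : S) : p \in degs P -> ~~ P j ->
  pihomog mdeg j p = 0.
Proof.
move=> /degsP hp hj; rewrite pihomogE big_seq_cond big_pred0 // => m.
by apply: contraNF hj => /andP[/hp + /eqP <-].
Qed.

Hypotheses (hd : (0 < d)%N) (hr : (0 < r)%N) (hr' : (0 < r')%N).

(** In the lowest degree s only the constant term of f acts: this makes the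
    truncation to lowest degree linear over S^(d) for the concentrated structure. *)
Lemma pihomog_ver s (f : R) (x : vermod k n d s) :
  pihomog mdeg s (val f * val x) = (val f)@_0%MM *: pihomog mdeg s (val x).
Proof.
have [f' hf' {1}->] := ver_split f.
rewrite /= mulrDl mul_mpolyC linearP [X in _ + X](_ : _ = 0) ?addr0 //.
apply: (@pihomog_degs (fun j => s < j)%N); last by rewrite ltnn.
by apply: degsM hf' (valP x) => a b /andP[da _] /andP[sb _]; lia.
Qed.

Lemma low_subproof s (p : S) : pihomog mdeg s p \in vermod_pred d s.
Proof. by apply/degsP => m /(dhomogP _ _ _ (pihomogP _ _ _)) ->; exact: vermod_deg_refl. Qed.
Definition low s (p : S) : vermod k n d s := VerMod (low_subproof s p).

Lemma lowP s a (p q : S) : low s (a *: p + q) = Rc a *: low s p + low s q.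
Proof. by apply: val_inj; rewrite /= linearP mul_mpolyC. Qed.

Lemma low_homog s (p : S) : p \is s.-homog -> val (low s p) = p.
Proof. exact: pihomog_dE. Qed.

Lemma row_homog (y : forall i, dhomog n k #|rowset D i|) i :
  val (y i) \is (if i == ord0 then r' else r).-homog.
Proof. by rewrite -card_rowset //; exact: dhomog_is_dhomog. Qed.

Lemma lowtens_mlin : mlin (P := krestr T)
  (fun y : forall i, dhomog n k #|rowset D i| =>
     tmul (low r (val (y ord_max))) (low r' (val (y ord0)))).
Proof.
move=> i a x x1 x2 xi e1 e2.
case: (eqVneq i ord0) xi e1 e2 => [->|i0] xi e1 e2.
  have i1 : ord_max != ord0 :> 'I_2 by [].
  by rewrite -(e1 _ i1) -(e2 _ i1) xi (lowP r' a) tmulPr.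
have i1 : i = ord_max by apply: val_inj; case: (i) i0 => [[|[|]]].
move: i1 xi e1 e2 => {i0}-> xi e1 e2.
have i2 : ord0 != ord_max :> 'I_2 by [].
by rewrite -(e1 _ i2) -(e2 _ i2) xi (lowP r a) tmulPl.
Qed.
(** S_r' (x)_k S_r -> T, which identifies its source with the part of T of degree
    r + r'; lowpart is its retraction. *)
Definition lowtens : {linear symrows -> krestr T} := mtlift lowtens_mlin.

Lemma lowtensE y : lowtens (mtmul y) = tmul (low r (val (y ord_max))) (low r' (val (y ord0))).
Proof. exact: (mtliftE lowtens_mlin). Qed.

Lemma val_rowpair p q i :
  val (rowpair p q i) = pihomog mdeg (if i == ord0 then r' else r) (if i == ord0 then q else p).
Proof. by rewrite /= card_rowset. Qed.

Lemma lowpart_bilin : bilin (P := concentrated n d symrows)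
  (fun (x : M) (y : M') => mtmul (rowpair (val x) (val y))).
Proof.
have hD s (f : R) (x y : vermod k n d s) : pihomog mdeg s (val (f *: x + y)) =
    (val f)@_0%MM *: pihomog mdeg s (val x) + pihomog mdeg s (val y).
  by rewrite -pihomog_ver -linearD.
split=> [a x1 x2 y|a x y1 y2].
  apply: (mtmul_mlin (i := ord_max)) => [|j jm|j jm]; apply: val_inj.
  - by rewrite val_rowpair hD /= !card_rowset.
  - by rewrite !val_rowpair; case: j jm => [[|[|]]].
  - by rewrite !val_rowpair; case: j jm => [[|[|]]].
apply: (mtmul_mlin (i := ord0)) => [|j jm|j jm]; apply: val_inj.
- by rewrite val_rowpair hD /= !card_rowset.
- by rewrite !val_rowpair (negPf jm).
- by rewrite !val_rowpair (negPf jm).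
Qed.
Definition lowpart : {linear T -> concentrated n d symrows} := tlift lowpart_bilin.

Lemma lowpartE x y : lowpart (tmul x y) = mtmul (rowpair (val x) (val y)).
Proof. exact: (tliftE lowpart_bilin). Qed.

Lemma rowpair_eq p q (y : forall i, dhomog n k #|rowset D i|) :
  pihomog mdeg r p = val (y ord_max) -> pihomog mdeg r' q = val (y ord0) ->
  rowpair p q = y.
Proof.
move=> ep eq; apply: functional_extensionality_dep => i; apply: val_inj.
rewrite val_rowpair; case: ifP => [/eqP -> //|i0].
by have -> // : i = ord_max; apply: val_inj; case: i i0 => [[|[|]]].
Qed.

Lemma lowpart_lowtens y : lowpart (lowtens y) = y.
Proof.
elim/mtens_ind: y => [|a y z IH]; first by rewrite !raddf0.
have lowpartZ : lowpart (Rc a *: (lowtens (mtmul y) : T) + lowtens z) =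
    a *: (lowpart (lowtens (mtmul y)) : symrows) + lowpart (lowtens z).
  rewrite (linearP lowpart) /= {1}/GRing.scale /=.
  by rewrite /conc_scale /= mcoeffC eqxx mulr1.
rewrite linearP [LHS]lowpartZ IH lowtensE lowpartE; congr (_ *: mtmul _ + _).
apply: rowpair_eq; rewrite low_homog ?pihomog_dE //; exact: row_homog.
Qed.

Lemma lowpart_tmon u v : vermod_deg d r (mdeg u) -> vermod_deg d r' (mdeg v) ->
  lowpart (tmon u v) = mtmul (rowpair 'X_[u] 'X_[v]).
Proof. by move=> hu hv; rewrite lowpartE !vmonE. Qed.

Lemma lowpart_eq0 a b x y : vermod_homog a x -> vermod_homog b y -> (a != r) || (b != r') ->
  lowpart (tmul x y) = 0.
Proof.
move=> hx hy /orP[] ne; rewrite lowpartE.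
  apply: (mlin0 (i := ord_max) (@mtmul_mlin _ _ _)).
  by apply: val_inj; rewrite val_rowpair (pihomog_ne0 ne hx).
apply: (mlin0 (i := ord0) (@mtmul_mlin _ _ _)).
by apply: val_inj; rewrite val_rowpair (pihomog_ne0 ne hy).
Qed.

Lemma lowtens_lowpart_tmon u v : mdeg u = r -> mdeg v = r' ->
  lowtens (lowpart (tmon u v)) = tmon u v.
Proof.
move=> du dv; rewrite lowpart_tmon ?du ?dv ?vermod_deg_refl // lowtensE.
by congr tmul; apply: val_inj; rewrite vmonE ?du ?dv ?vermod_deg_refl // -[val (low _ _)]/(pihomog _ _ _)
   val_rowpair /= pihomogX /= ?du ?dv eqxx pihomogX /= ?du ?dv eqxx.
Qed.

Lemma phi_lowtens y : val (phi (lowtens y)) = symmul y.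
Proof.
elim/mtens_ind: y => [|a y z IH]; first by rewrite !raddf0.
have e : phi (Rc a *: (lowtens (mtmul y) : T) + lowtens z) =
  Rc a *: phi (lowtens (mtmul y)) + phi (lowtens z) by exact: linearP.
rewrite linearP [RHS]linearP -IH -[in LHS]/(Rc a *: (lowtens (mtmul y) : T)) e.
rewrite val_verCP; congr (_ *: _ + _).
rewrite lowtensE phiE symmulE big_ord_recl big_ord1 mulrC.
have -> : fintype.lift ord0 ord0 = ord_max :> 'I_2 by exact: val_inj.
rewrite -[val (vermul _ _)]/(val _ * val _).
rewrite !low_homog; [by []| exact: row_homog | exact: row_homog].
Qed.

End LowDegree.

(** * Splitting off the kernel *)

Section Splitting.
Variables (k : comUnitRingType) (n d r r' : nat).
Hypotheses (hd : (0 < d)%N) (hr : (0 < r)%N) (hr' : (0 < r')%N).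
Local Notation S := {mpoly k[n]}.
Local Notation R := (veronese k n d).
Local Notation M := (vermod k n d r).
Local Notation M' := (vermod k n d r').
Local Notation M'' := (vermod k n d (r + r')).
Local Notation T := (tens M M').
Local Notation Rc := (verC n d).
Local Notation tmon := (@tmon k n d r r').
Local Notation phi := (mult_map k n d r r').
Local Notation D := (ribbon r r').
Local Notation symrows := (symrows k n D).
Local Notation rowpair := (@rowpair k n r r').
Local Notation lowtens := (@lowtens k n d r r').
Local Notation lowpart := (@lowpart k n d r r' hd hr hr').
Local Notation monsec := (@monsec k n d r r').
Local Notation Ssigma := (concentrated n d (schur k n D)).

Lemma conc_scale_const (W : lmodType k) a (x : concentrated n d W) :
  Rc a *: x = a *: (x : W) :> W.
Proof. by rewrite -[LHS]/((val (Rc a))@_0%MM *: (x : W)) mcoeffC eqxx mulr1. Qed.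

Lemma lowpart_k a x y :
  lowpart (Rc a *: x + y) = a *: (lowpart x : symrows) + (lowpart y : symrows) :> symrows.
Proof. by rewrite (linearP lowpart) (conc_scale_const a (lowpart x)). Qed.

Lemma lowtens_lowpart_k_linear : k_linear (fun t : T => lowtens (lowpart t) : T).
Proof. by move=> a x y; rewrite lowpart_k; exact: (linearP lowtens). Qed.

(** The projection onto the kernel of phi along the section. The two lemmas
    lowtens_lowpart_defect and lowpart_defect say that it takes its values in the
    copy of the Schur functor inside the degree r + r' part of T. *)
Definition defect (t : T) : T := t - monsec (phi t).

Lemma monsec_phi_k_linear : k_linear (fun t => monsec (phi t)).
Proof. exact: (k_linear_comp (@monsec_k_linear k n d r r') (k_linear_lin phi)). Qed.

Lemma defect_k_linear : k_linear defect.
Proof.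
move=> a x y; rewrite /defect monsec_phi_k_linear scalerBr opprD addrACA.
by [].
Qed.

Lemma defect_tmon u v : vermod_deg d r (mdeg u) -> vermod_deg d r' (mdeg v) ->
  (r + r' < mdeg u + mdeg v)%N -> defect (tmon u v) = 0.
Proof. by move=> hu hv gt; rewrite /defect monsec_phi_tmon ?subrr. Qed.

Lemma vermod_deg_min u v : vermod_deg d r u -> vermod_deg d r' v ->
  (u + v <= r + r')%N -> u = r /\ v = r'.
Proof. by move=> /andP[ru _] /andP[rv _]; lia. Qed.

(** On a tensor of monomials of degree > r + r' the defect vanishes; in degree
    r + r' the map lowtens inverts lowpart. *)
Lemma lowtens_lowpart_defect t : lowtens (lowpart (defect t)) = defect t.
Proof.
move: t; apply: (tmon_eq (k_linear_comp lowtens_lowpart_k_linear defect_k_linear)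
  defect_k_linear) => u v hu hv; rewrite /comp.
case: (ltnP (r + r') (mdeg u + mdeg v)) => [gt|le].
  by rewrite defect_tmon // !raddf0.
have [du dv] := vermod_deg_min hu hv le.
have hm : vermod_deg d (r + r') (mdeg (u + v)%MM) by rewrite mdegD vermod_degD.
rewrite /defect phi_tmon // monsec_vmon // (k_linear_zmod lowtens_lowpart_k_linear) !lowtens_lowpart_tmon //.
- by rewrite mdeg_mnmtake // mdegD du; lia.
- by rewrite mdeg_subm ?mnmtake_le // mdeg_mnmtake ?mdegD ?du ?dv; lia.
Qed.

(** In degree r + r', the defect of a tensor of monomials is the difference of two
    factorizations of the same monomial. *)
Lemma lowpart_defect t : lowpart (defect t) \in @schur_pred k n _ _ D.
Proof.
elim/tmon_ind: t => [|a x y hx hy|u v hu hv].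
- by rewrite (k_linear0 defect_k_linear) raddf0 rpred0.
- rewrite defect_k_linear lowpart_k.
  by have [_ closedP] := @schur_closed k n _ _ D; exact: (closedP a _ _ hx hy).
case: (ltnP (r + r') (mdeg u + mdeg v)) => [gt|le].
  by rewrite defect_tmon // raddf0 rpred0.
have [du dv] := vermod_deg_min hu hv le.
have dm : mdeg (u + v)%MM = (r + r')%N by rewrite mdegD du dv.
have hm : vermod_deg d (r + r') (mdeg (u + v)%MM) by rewrite mdegD vermod_degD.
have [dt vt] := vermod_deg_take hm.
rewrite /defect phi_tmon // monsec_vmon // (linearB lowpart) !lowpart_tmon ?dt ?vermod_deg_refl //.
have -> : 'X_[k, v] = 'X_[u + v - u] by rewrite addmC addmK.
by apply: schur_exchange_mon => //; [exact: lem_addr | exact: mnmtake_le].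
Qed.

Definition ribbon_proj (t : T) : Ssigma := Defs.Schur (lowpart_defect t).

Definition ribbon_incl (x : Ssigma) : T := lowtens (val (x : schur k n D)).

Lemma phi_ribbon_incl x : phi (ribbon_incl x) = 0.
Proof.
apply: val_inj; rewrite /ribbon_incl (phi_lowtens d hr hr').
by case: x => _ /= /asboolP[t <-]; rewrite symmul_schur_map.
Qed.

(** R_+ annihilates the image: f x = monsec(phi(f x)) by monsec_phi_Rplus, and phi
    kills x. *)
Lemma ribbon_incl_linear : linear ribbon_incl.
Proof.
have inclD x y : ribbon_incl (x + y) = ribbon_incl x + ribbon_incl y by exact: raddfD.
have inclZ a (x : schur k n D) : ribbon_incl (a *: x) = Rc a *: ribbon_incl x.
  by rewrite /ribbon_incl linearZ.
move=> f x y; rewrite inclD; congr (_ + _).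
rewrite -[f *: x]/((val f)@_0%MM *: (x : schur k n D)) inclZ.
(* Only the copy of f that acts in T is split into constant term and R_+ part. *)
have [f' hf' {2}->] := ver_split f.
rewrite scalerDl -(monsec_phi_Rplus hd hr _ hf') (linearZ_LR phi) phi_ribbon_incl scaler0.
by rewrite (k_linear0 (@monsec_k_linear k n d r r')) addr0.
Qed.

Definition ribbon_incl_lin : {linear Ssigma -> T} :=
  linear_of ribbon_incl_linear.

Lemma ribbon_proj_linear : linear ribbon_proj.
Proof.
move=> f x y; apply: val_inj.
have dl : defect (f *: x + y) = f *: defect x + defect y.
  rewrite /defect (linearP phi) (monsec_linear hd hr) scalerBr opprD addrACA.
  by [].
by rewrite -[LHS]/(lowpart (defect (f *: x + y))) dl (linearP lowpart).
Qed.

Lemma ribbon_incl_ribbon_proj t : ribbon_incl (ribbon_proj t) = t - monsec (phi t).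
Proof. exact: lowtens_lowpart_defect. Qed.

Lemma ribbon_proj_ribbon_incl x : ribbon_proj (ribbon_incl x) = x.
Proof.
apply: val_inj; rewrite -[LHS]/(lowpart (defect (ribbon_incl x))) /defect phi_ribbon_incl.
by rewrite (k_linear0 (@monsec_k_linear k n d r r')) subr0 /ribbon_incl lowpart_lowtens.
Qed.

Lemma ribbon_proj_monsec m : ribbon_proj (monsec m) = 0.
Proof.
apply: val_inj; rewrite -[LHS]/(lowpart (defect (monsec m))) /defect monsecK subrr.
exact: raddf0.
Qed.

Definition split_fun (t : T) : (M'' * Ssigma)%type := (phi t, ribbon_proj t).

Lemma split_linear : linear split_fun.
Proof. by move=> f x y; rewrite /split_fun (linearP phi) ribbon_proj_linear. Qed.

Definition split_lin : {linear T -> (M'' * Ssigma)%type} :=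
  linear_of split_linear.

Lemma split_bij : bijective split_fun.
Proof.
exists (fun z => monsec z.1 + ribbon_incl z.2) => [t|[m x]].
  by rewrite /= ribbon_incl_ribbon_proj addrC subrK.
rewrite /= -[monsec m]scale1r split_linear scale1r /split_fun.
by rewrite monsecK ribbon_proj_monsec phi_ribbon_incl ribbon_proj_ribbon_incl; congr (_, _); rewrite (addr0, add0r).
Qed.

End Splitting.

(** * Gradings and the action of the general linear group *)

Section GradingAndAction.
Variables (k : comUnitRingType) (n d r r' : nat).
Hypotheses (hd : (0 < d)%N) (hr : (0 < r)%N) (hr' : (0 < r')%N).
Local Notation S := {mpoly k[n]}.
Local Notation R := (veronese k n d).
Local Notation M := (vermod k n d r).
Local Notation M' := (vermod k n d r').
Local Notation M'' := (vermod k n d (r + r')).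
Local Notation T := (tens M M').
Local Notation Rc := (verC n d).
Local Notation phi := (mult_map k n d r r').
Local Notation D := (ribbon r r').
Local Notation symrows := (symrows k n D).
Local Notation lowtens := (@lowtens k n d r r').
Local Notation lowpart := (@lowpart k n d r r' hd hr hr').
Local Notation monsec := (@monsec k n d r r').
Local Notation homT := (@tens_homog k n d r r').

Lemma tens_homog0 j : homT j 0. Proof. by move=> P P0. Qed.

Lemma tens_homogB j s t : homT j s -> homT j t -> homT j (s - t).
Proof.
move=> hs ht P P0 PB PX.
by apply: (PB); [exact: (hs P P0 PB PX) | exact: (ht P P0 PB PX)].
Qed.

Lemma tens_homogD j s t : homT j s -> homT j t -> homT j (s + t).
Proof.
move=> hs ht; rewrite -[t]opprK -[- t]sub0r.
by apply: tens_homogB => //; apply: tens_homogB => //; exact: tens_homog0.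
Qed.

Lemma tens_homog_tmul a b (x : M) (y : M') : vermod_homog a x -> vermod_homog b y ->
  homT (a + b) (tmul x y).
Proof. by move=> hx hy P P0 PB PX; exact: PX hx hy. Qed.

Lemma tens_homogZ j c t : homT j t -> homT j (Rc c *: t).
Proof.
move=> ht; apply: (ht (fun t => homT j (Rc c *: t))) => [|u v hu hv|a b x y <- hx hy].
- by rewrite scaler0; exact: tens_homog0.
- by rewrite scalerBr; exact: tens_homogB.
rewrite -tmulZl; apply: tens_homog_tmul => //.
by rewrite /vermod_homog val_verCZ rpredZ.
Qed.

Lemma vmon_homog s (u : 'X_{1..n}) : vermod_homog (mdeg u) (vmon k d s u).
Proof.
rewrite /vermod_homog; case: (boolP (vermod_deg d s (mdeg u))) => hu.
  by rewrite vmonE // dhomogX.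
by rewrite vmon0 // rpred0.
Qed.

Lemma low_vermod_homog s (p : S) : vermod_homog s (low d s p).
Proof. exact: pihomogP. Qed.

Lemma lowtens_homog y : homT (r + r') (lowtens y).
Proof.
elim/mtens_ind: y => [|a y z IH]; first by rewrite raddf0; exact: tens_homog0.
rewrite linearP; apply: tens_homogD IH; apply: (@tens_homogZ _ a).
by rewrite lowtensE; apply: tens_homog_tmul; exact: low_vermod_homog.
Qed.

Lemma ribbon_incl_graded : graded (conc_homog (r + r')) homT (@ribbon_incl k n d r r').
Proof.
move=> j x [->|->]; first exact: lowtens_homog.
by rewrite (_ : ribbon_incl _ = 0); [exact: tens_homog0 | exact: (raddf0 lowtens)].
Qed.

Lemma phi_graded : graded homT (@vermod_homog k n d (r + r')) phi.
Proof.
move=> j t ht; apply: (ht (fun t => vermod_homog j (phi t))).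
- by rewrite raddf0 /vermod_homog rpred0.
- by move=> u v hu hv; rewrite (linearB phi) /vermod_homog rpredB.
- by move=> a b x y <- hx hy; rewrite phiE /vermod_homog dhomogM.
Qed.

Lemma monsec_graded : graded (@vermod_homog k n d (r + r')) homT monsec.
Proof.
move=> j x hx; rewrite /monsec /mon_ext big_seq.
elim/big_ind: _ => [|s t|u hu]; [exact: tens_homog0 | exact: tens_homogD | apply: tens_homogZ].
have <- : mdeg u = j by exact: (dhomogP _ _ _ hx).
by rewrite -[mdeg u](congr1 mdeg (mnmtakeK r u)) mdegD; apply: tens_homog_tmul; exact: vmon_homog.
Qed.

Lemma lowpart_graded : graded homT (conc_homog (r + r')) lowpart.
Proof.
move=> j t ht; case: (eqVneq j (r + r')%N) => [->|jr]; [by left | right].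
apply: (ht (fun t => lowpart t = 0)) => [|u v hu hv|a b x y ab hx hy].
- exact: raddf0.
- by rewrite (linearB lowpart) hu hv subrr.
apply: lowpart_eq0 hx hy _; apply: contraNT jr; rewrite negb_or !negbK.
by move=> /andP[/eqP <- /eqP <-]; rewrite ab.
Qed.

Lemma ribbon_proj_graded : graded homT (conc_homog (r + r')) (@ribbon_proj k n d r r' hd hr hr').
Proof.
move=> j t ht; have : homT j (defect t).
  by apply: (tens_homogB ht); apply: monsec_graded; exact: (phi_graded ht).
case/lowpart_graded => [->|h0]; [by left | right].
by apply: (@val_inj _ _ (schur k n D)); exact: h0.
Qed.

Section Action.
Variable g : 'M[k]_n.

(** The diagonal action is semilinear over the action on S^(d), and the latter fixes
    the constants, so the diagonal action is k-linear. *)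
Lemma gl_tensP f x y :
  gl_tens g (f *: x + y : T) = gl_ver g f *: gl_tens g x + gl_tens g y.
Proof. exact: (linearP (tlift (@gl_tens_bilin k n d r r' g)) f x y). Qed.

Lemma gl_tens0 : gl_tens g (0 : T) = 0.
Proof. exact: (linear0 (tlift (@gl_tens_bilin k n d r r' g))). Qed.

Lemma gl_ver_const a : gl_ver g (Rc a) = Rc a.
Proof. by apply: val_inj; rewrite /= /gl_poly comp_mpolyC. Qed.

Lemma gl_tens_k_linear : k_linear (gl_tens g : T -> T).
Proof. by move=> a x y; rewrite gl_tensP gl_ver_const. Qed.

Lemma gl_vermodP s f (x y : vermod k n d s) :
  gl_vermod g (f *: x + y) = gl_ver g f *: gl_vermod g x + gl_vermod g y.
Proof. by apply: val_inj; rewrite /= rmorphD rmorphM. Qed.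

Lemma gl_vermod_k_linear s : k_linear (@gl_vermod k n d s g).
Proof. by move=> a x y; rewrite gl_vermodP gl_ver_const. Qed.

Lemma phi_gl t : phi (gl_tens g t) = gl_vermod g (phi t).
Proof.
elim/tens_ind: t => [|f x y z IH].
  by rewrite gl_tens0 !raddf0 (k_linear0 (@gl_vermod_k_linear _)).
rewrite gl_tensP !(linearP phi) gl_vermodP IH gl_tensE !phiE; congr (_ *: _ + _).
by apply: val_inj; rewrite /= rmorphM.
Qed.

Lemma gl_low_homog s j (p : S) : p \is j.-homog ->
  low d s (gl_poly g p) = gl_vermod g (low d s p).
Proof.
move=> hp; apply: val_inj => /=; have hgp := gl_poly_homog g hp.
case: (eqVneq j s) => [<-|js]; first by rewrite !pihomog_dE.
by rewrite (pihomog_ne0 js hp) (pihomog_ne0 js hgp) raddf0.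
Qed.

Lemma lowtens_gl y : lowtens (gl_rows D g y) = gl_tens g (lowtens y).
Proof.
elim/mtens_ind: y => [|a y z IH]; first by rewrite !raddf0 gl_tens0.
have -> : gl_tens g (lowtens (a *: mtmul y + z)) =
  Rc a *: gl_tens g (lowtens (mtmul y)) + gl_tens g (lowtens z).
  by rewrite linearP -gl_tens_k_linear.
rewrite !linearP IH; congr (_ + _); rewrite -[LHS]/(Rc a *: _); congr (_ *: _).
rewrite /gl_rows mtmapE !lowtensE gl_tensE /=.
by congr tmul; apply: gl_low_homog; exact: row_homog.
Qed.

Lemma ribbon_incl_gl x : ribbon_incl (gl_schur g x) = gl_tens g (@ribbon_incl k n d r r' x).
Proof. exact: lowtens_gl. Qed.

End Action.
End GradingAndAction.

(** * Polarization and the equivariant section *)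

Section Comultiplication.
Variables (k : comUnitRingType) (n : nat).
Local Notation S := {mpoly k[n]}.
Local Notation SS := {mpoly S[n]}.

(** p(x) |-> p(x + y), with the polynomials in y as coefficients and x as the
    variables: the coproduct of the symmetric algebra. *)
Definition comul : S -> SS :=
  mmap (@mpolyC n S \o @mpolyC n k) (fun i => 'X_i + ('X_i)%:MP).

HB.instance Definition _ := GRing.RMorphism.copy comul
  (mmap (@mpolyC n S \o @mpolyC n k) (fun i => 'X_i + ('X_i)%:MP)).

Local Notation emb := (map_mpoly (@mpolyC n k) : S -> SS).

Lemma comulZ a p : comul (a *: p) = a%:MP *: comul p.
Proof. by rewrite /comul mmapZ /= mul_mpolyC. Qed.

Lemma comul_linform (v : 'cV[k]_n) : comul (linform v) = emb (linform v) + (linform v)%:MP.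
Proof.
rewrite /linform !raddf_sum -big_split /=; apply: eq_bigr => i _.
rewrite comulZ map_mpolyZ map_mpolyX /= /comul mmapX mmap1U scalerDr; congr (_ + _).
by rewrite -!mul_mpolyC -mpolyCM.
Qed.

Lemma comul_prod N (v : 'I_N -> 'cV[k]_n) :
  comul (\prod_i linform (v i)) =
  \sum_(A : {set 'I_N}) emb (\prod_(i in A) linform (v i)) *
                        (\prod_(i in ~: A) linform (v i))%:MP.
Proof.
rewrite rmorph_prod; under eq_bigr do rewrite /= comul_linform.
rewrite bigA_distr; apply: eq_bigr => A _; rewrite rmorph_prod.
rewrite [X in _ * X](rmorph_prod (@mpolyC n S)).
rewrite (bigID (mem A)) /=; congr (_ * _).
  by apply: eq_bigr => i ->.
by apply: eq_big => [i|i /negPf ->]; rewrite ?inE.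
Qed.

Variables (d r r' : nat).
Local Notation T := (tens (vermod k n d r) (vermod k n d r')).
Local Notation Rc := (verC n d).
Local Notation phi := (mult_map k n d r r').

(** The component of bidegree (r, r') in (x, y), read in the tensor product over
    S^(d). *)
Definition bicomp (P : SS) : T := mon_ext (fun u c => tmul (low d r 'X_[u]) (low d r' c)) P.

Lemma bicomp0 (u : 'X_{1..n}) : tmul (low d r 'X_[u]) (low d r' (0 : S)) = 0 :> T.
Proof.
rewrite (_ : low d r' 0 = 0) ?tmul0r //.
by apply: val_inj; rewrite /= linear0.
Qed.

Lemma bicompP a P Q : bicomp (a%:MP *: P + Q) = Rc a *: bicomp P + bicomp Q.
Proof.
apply: mon_ext_semilinear => [|u x y]; first exact: bicomp0.
by rewrite mul_mpolyC lowP tmulPr.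
Qed.

Lemma bicompD P Q : bicomp (P + Q) = bicomp P + bicomp Q.
Proof. by have := bicompP 1 P Q; rewrite mpolyC1 rmorph1 !scale1r. Qed.

Lemma bicomp_sum I (s : seq I) F : bicomp (\sum_(i <- s) F i) = \sum_(i <- s) bicomp (F i).
Proof.
apply: (big_morph _ bicompD).
by rewrite /bicomp /mon_ext msupp0 big_nil.
Qed.

Lemma low_sum s I (l : seq I) (F : I -> S) :
  low d s (\sum_(i <- l) F i) = \sum_(i <- l) low d s (F i).
Proof. by apply: val_inj; rewrite val_sum /= linear_sum. Qed.

Lemma lowZ s a p : low d s (a *: p : S) = Rc a *: low d s p.
Proof. by apply: val_inj; rewrite val_verCZ /= linearZ. Qed.

Lemma bicomp_emb p q : bicomp (emb p * q%:MP) = tmul (low d r p) (low d r' q).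
Proof.
rewrite [in LHS](mpolyE p) [in RHS](mpolyE p) raddf_sum mulr_suml low_sum bicomp_sum.
elim: (msupp p) => [|u s IH]; first by rewrite !big_nil tmul0l.
rewrite !big_cons -[X in tmul (X + _) _]scale1r tmulPl scale1r -IH; congr (_ + _).
rewrite /= map_mpolyZ map_mpolyX -scalerAl ['X_[u] * _]mulrC mul_mpolyC scalerA /=.
rewrite /bicomp mon_ext_monomial; last exact: bicomp0.
by rewrite mul_mpolyC !lowZ tmulZl tmulZr.
Qed.

(** Complete polarization. The formula polar_prod on products of linear forms is
    visibly equivariant; comul is what shows that the formula is well defined. *)
Definition polar (p : S) : T := bicomp (comul p).

Lemma polarP a p q : polar (a *: p + q) = Rc a *: polar p + polar q.
Proof.
rewrite /polar.
have -> : comul (a *: p + q) = a%:MP *: comul p + comul q by rewrite -comulZ -rmorphD.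
exact: bicompP.
Qed.

Lemma polar_prod N (v : 'I_N -> 'cV[k]_n) :
  polar (\prod_i linform (v i)) =
  \sum_(A : {set 'I_N}) tmul (low d r (\prod_(i in A) linform (v i)))
                             (low d r' (\prod_(i in ~: A) linform (v i))).
Proof.
by rewrite /polar comul_prod bicomp_sum; apply: eq_bigr => A _; rewrite bicomp_emb.
Qed.

Lemma prod_set_homog N (v : 'I_N -> 'cV[k]_n) (A : {set 'I_N}) :
  \prod_(i in A) linform (v i) \is #|A|.-homog.
Proof.
rewrite big_enum_val; apply: prod_homog => b; exact: linform_homog.
Qed.

Lemma mpolyX_linforms (m : 'X_{1..n}) :
  exists v : 'I_(mdeg m) -> 'cV[k]_n, 'X_[m] = \prod_i linform (v i).
Proof.
have [f ->] := mpolyX_factors k (erefl (mdeg m)).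
by exists (fun i => cvbase k (f i)); apply: eq_bigr => i _; rewrite linform_cvbase.
Qed.

(** Only the subsets A of size r contribute, each of them the whole product, and
    there are binomial(r + r', r) of them; outside of degree r + r' no term
    survives, as one of its two factors has the wrong degree. *)
Lemma phi_polarX (m : 'X_{1..n}) : val (phi (polar 'X_[m])) =
  if mdeg m == (r + r')%N then ('C(r + r', r))%:R *: 'X_[m] else 0.
Proof.
(* As product of linear forms, the monomial has a polarization indexed by subsets. *)
have [v ev] := mpolyX_linforms m.
rewrite ev polar_prod (k_linear_sum _ _ (k_linear_lin phi)) val_sum.
have term (A : {set 'I_(mdeg m)}) :
  val (phi (tmul (low d r (\prod_(i in A) linform (v i)))
                 (low d r' (\prod_(i in ~: A) linform (v i))))) =
  if (#|A| == r) && (mdeg m == (r + r')%N) then 'X_[m] else 0.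
  have hA := prod_set_homog v A; have hC := prod_set_homog v (~: A).
  have cA := cardsC A; rewrite card_ord in cA.
  rewrite phiE -[val (vermul _ _)]/(pihomog mdeg r _ * pihomog mdeg r' _).
  case: (eqVneq #|A| r) => [Ar|Ar]; last by rewrite (pihomog_ne0 Ar) ?mul0r.
  case: (eqVneq #|~: A| r') => [Cr|Cr].
    have -> : mdeg m == (r + r')%N by rewrite -cA Ar Cr.
    rewrite /= !pihomog_dE -?Ar -?Cr // ev.
    rewrite [RHS](bigID (mem A)) /=; congr (_ * _).
    by apply: eq_bigl => i; rewrite inE.
  rewrite (pihomog_ne0 Cr) // mulr0 ifN //; apply: contra Cr => /eqP e.
  by rewrite -(eqn_add2l #|A|) cA {1}Ar; apply/eqP.
rewrite (eq_bigr _ (fun A _ => term A)) -big_mkcond /=; case: (eqVneq (mdeg m) (r + r')%N) => [dm|_]; last first.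
  by rewrite big_pred0 // => A; rewrite andbF.
under eq_bigl do rewrite andbT.
rewrite sumr_const -ev -scaler_nat; congr (_ %:R *: _).
rewrite -[(r + r')%N]dm -[X in 'C(X, _)](card_ord (mdeg m)) -card_draws.
by apply: eq_card => A; rewrite !inE.
Qed.

Lemma polar_mon_ext p : polar p = \sum_(u <- msupp p) Rc p@_u *: polar 'X_[u].
Proof.
rewrite {1}[p]mpolyE; elim: (msupp p) => [|u s IH].
  by have := polarP (-1) 0 0; rewrite !big_nil scaler0 addr0 rmorphN rmorph1 scaleN1r addNr.
by rewrite !big_cons polarP IH.
Qed.

(** Products of linear forms span S, and the action on them is through the forms. *)
Lemma polar_gl g p : polar (gl_poly g p) = gl_tens g (polar p).
Proof.
have polarX u : polar (gl_poly g 'X_[u]) = gl_tens g (polar 'X_[u]).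
  have [v ->] := mpolyX_linforms u.
  rewrite polar_prod (k_linear_sum _ _ (@gl_tens_k_linear k n d r r' g)).
  have glprod (A : {set 'I_(mdeg u)}) : \prod_(i in A) linform (g *m v i) =
      gl_poly g (\prod_(i in A) linform (v i)).
    by rewrite rmorph_prod; apply: eq_bigr => i _; rewrite /= gl_poly_linform.
  have -> : gl_poly g (\prod_i linform (v i)) = \prod_i linform (g *m v i).
    by rewrite rmorph_prod; apply: eq_bigr => i _; rewrite /= gl_poly_linform.
  rewrite polar_prod; apply: eq_bigr => A _.
  by rewrite gl_tensE !glprod !(gl_low_homog _ _ _ (prod_set_homog v _)).
rewrite [polar p]polar_mon_ext (k_linear_sum _ _ (@gl_tens_k_linear k n d r r' g)).
rewrite {1}[p]mpolyE; elim: (msupp p) => [|u s IH].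
  rewrite !big_nil linear0; by have := polar_mon_ext 0; rewrite msupp0 big_nil.
rewrite !big_cons linearP polarP IH polarX.
by rewrite -(k_linearZ p@_u (polar 'X_[u]) (@gl_tens_k_linear k n d r r' g)).
Qed.

Hypotheses (hd : (0 < d)%N) (hr : (0 < r)%N).
Local Notation M'' := (vermod k n d (r + r')).
Local Notation monsec := (@monsec k n d r r').

Section EquivariantSection.
Hypothesis binU : ('C(r + r', r))%:R \is a @GRing.unit k.
Local Notation c := (('C(r + r', r))%:R^-1 : k).

Definition polar_sec (x : M'') : T := Rc c *: polar (val x).

Lemma polar_sec_k_linear : k_linear polar_sec.
Proof.
move=> a x y; rewrite /polar_sec val_verCP polarP scalerDr !scalerA.
by rewrite [Rc c * _]mulrC.
Qed.

Lemma polar_sec_gl g x : polar_sec (gl_vermod g x) = gl_tens g (polar_sec x).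
Proof. by rewrite /polar_sec polar_gl (k_linearZ c (polar (val x)) (@gl_tens_k_linear k n d r r' g)). Qed.

(** polar_sec is an equivariant section in degree r + r' and vanishes in the other
    degrees, so this is the equivariant truncation to degrees > r + r'. *)
Definition highpart (x : M'') : M'' := x - phi (polar_sec x).

Lemma highpart_k_linear : k_linear highpart.
Proof.
move=> a x y; rewrite /highpart polar_sec_k_linear (linearP phi) scalerBr opprD addrACA.
by [].
Qed.

Lemma highpart_gl g x : highpart (gl_vermod g x) = gl_vermod g (highpart x).
Proof.
rewrite /highpart polar_sec_gl phi_gl.
by rewrite (k_linear_zmod (@gl_vermod_k_linear k n d g _)).
Qed.

Lemma phi_polar_sec (m : 'X_{1..n}) : vermod_deg d (r + r') (mdeg m) ->
  phi (polar_sec (vmon k d (r + r') m)) =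
  if mdeg m == (r + r')%N then vmon k d (r + r') m else 0.
Proof.
move=> hm; apply: val_inj; rewrite (linearZ_LR phi) val_verCZ vmonE // phi_polarX.
case: ifP => _; last by rewrite scaler0.
by rewrite vmonE // scalerA mulVr ?scale1r.
Qed.

(** On R_+ M'' the choices made in monsec do not matter: the two sides lie
    in R_+ T and have the same image under phi. *)
Lemma monsec_gl_Rplus g (f : veronese k n d) x : val f \in vermod_pred d d ->
  monsec (gl_vermod g (f *: x)) = gl_tens g (monsec (f *: x)).
Proof.
move=> hf; have hgf : val (gl_ver g f) \in vermod_pred d d by exact: gl_degs.
have glZ s (y : vermod k n d s) : gl_vermod g (f *: y) = gl_ver g f *: gl_vermod g y.
  by apply: val_inj; rewrite /= rmorphM.
have glTZ t : gl_tens g (f *: t) = gl_ver g f *: gl_tens g t :> T.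
  by have := gl_tensP g f t 0; rewrite gl_tens0 !addr0.
have sZ e y : monsec (e *: y) = e *: monsec y.
  have := monsec_linear hd hr e y 0.
  by rewrite (k_linear0 (@monsec_k_linear k n d r r')) !addr0.
rewrite glZ (sZ f) glTZ -(monsec_phi_Rplus hd hr _ hgf) (linearZ_LR phi) phi_gl monsecK.
by [].
Qed.

(** A monomial of degree > r + r' in M'' has degree at least r + r' + d, so it is
    divisible by a monomial of degree d and belongs to R_+ M''. *)
Lemma monsec_gl_highpart g x :
  monsec (gl_vermod g (highpart x)) = gl_tens g (monsec (highpart x)).
Proof.
have hk := highpart_k_linear; have sk := @monsec_k_linear k n d r r'.
have gk := @gl_vermod_k_linear k n d g (r + r'); have tk := @gl_tens_k_linear k n d r r' g.
move: x; apply: (vermod_eq (k_linear_comp sk (k_linear_comp gk hk))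
                           (k_linear_comp tk (k_linear_comp sk hk))) => m hm.
rewrite /comp /highpart phi_polar_sec //.
case: eqVneq => [dm|ne]; first by rewrite subrr (k_linear0 gk) (k_linear0 sk) (k_linear0 tk).
rewrite subr0; have [i dm] := vermod_degP _ _ _ hm.
have i0 : (0 < i)%N by rewrite lt0n; apply: contraNneq ne => i0; rewrite dm i0.
have dle : (d <= mdeg m)%N by rewrite dm; apply: leq_trans (leq_addr _ _); exact: leq_pmull.
have de : mdeg (mnmtake d m) = d by rewrite mdeg_mnmtake.
have dr : vermod_deg d (r + r') (mdeg (m - mnmtake d m)%MM).
  apply/vermod_degP; exists i.-1; rewrite mdeg_subm ?mnmtake_le // de dm.
  by case: (i) i0 => //= j _; rewrite mulSn -addnA addKn.
rewrite -[m](mnmtakeK d) -rmon_vmon ?de //.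
apply: monsec_gl_Rplus; rewrite rmonE ?de // degsX de.
by rewrite leqnn eqxx.
Qed.

Definition gl_sec (x : M'') : T := monsec (highpart x) + polar_sec x.

Lemma gl_sec_k_linear : k_linear gl_sec.
Proof.
move=> a x y; rewrite /gl_sec highpart_k_linear monsec_k_linear polar_sec_k_linear.
by rewrite scalerDr addrACA.
Qed.

Lemma gl_sec_equivariant g x : gl_sec (gl_vermod g x) = gl_tens g (gl_sec x).
Proof.
rewrite /gl_sec highpart_gl monsec_gl_highpart polar_sec_gl.
have := @gl_tens_k_linear k n d r r' g 1 (monsec (highpart x)) (polar_sec x).
by rewrite rmorph1 !scale1r.
Qed.

Lemma gl_secK : cancel gl_sec phi.
Proof.
by move=> x; rewrite /gl_sec linearD monsecK /highpart subrK.
Qed.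
End EquivariantSection.

End Comultiplication.

(** * The theorem *)

Theorem theorem1p6 (k : comUnitRingType) (n d r r' : nat)
  (hd : (1 <= d)%N) (hr : (1 <= r)%N) (hr' : (1 <= r')%N) :
  let R : comNzRingType := veronese k n d in
  let r'' := (r + r')%N in
  let M : lmodType R := vermod k n d r in
  let M' : lmodType R := vermod k n d r' in
  let M'' : lmodType R := vermod k n d r'' in
  let T : lmodType R := tens M M' in
  let phi : {linear T -> M''} := mult_map k n d r r' in
  let Ssigma : lmodType R := concentrated n d (schur k n (ribbon r r')) in
  let glS : 'M[k]_n -> Ssigma -> Ssigma := @gl_schur k n _ _ (ribbon r r') in
  let glT : 'M[k]_n -> T -> T := @gl_tens k n d r r' in
  let glM'' : 'M[k]_n -> M'' -> M'' := @gl_vermod k n d r'' in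
  let degS : nat -> Ssigma -> Prop := conc_homog r'' in
  let degT : nat -> T -> Prop := @tens_homog k n d r r' in
  let degM'' : nat -> M'' -> Prop := @vermod_homog k n d r'' in
  exists iota : {linear Ssigma -> T},
    [/\ [/\ short_exact iota phi,
            equivariant glS glT iota /\ equivariant glT glM'' phi,
            graded degS degT iota /\ graded degT degM'' phi &
            forall f : R, val f \in vermod_pred d d ->
              forall x : Ssigma, f *: x = 0],
        exists (s : {linear M'' -> T}) (h : {linear T -> (M'' * Ssigma)%type}),
          [/\ cancel s phi, bijective h,
              forall x : Ssigma, h (iota x) = (0, x),
              forall m : M'', h (s m) = (m, 0) &
              graded degM'' degT s /\
              graded degT (fun j z => degM'' j z.1 /\ degS j z.2) h] &
        ('C(r + r', r))%:R \is a @GRing.unit k ->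
          exists s : M'' -> T,
            [/\ k_linear s, equivariant glM'' glT s & cancel s phi]].
Proof.
exists (ribbon_incl_lin k n hd hr hr').
split; first split.
- split.
  + exact: (can_inj (ribbon_proj_ribbon_incl hd hr hr')).
  + move=> t; split=> [h0|[x <-]]; last exact: (phi_ribbon_incl hr hr').
    exists (ribbon_proj hd hr hr' t); apply: etrans (ribbon_incl_ribbon_proj hd hr hr' t) _.
    by rewrite h0 (k_linear0 (@monsec_k_linear k n d r r')) subr0.
  + by move=> z; exists (monsec z); exact: monsecK.
- split=> g _ x; [exact: ribbon_incl_gl | exact: phi_gl].
- by split; [exact: ribbon_incl_graded | exact: phi_graded].
- move=> f /degsP hf x.
  have f0 : (val f)@_0%MM = 0.
    apply: memN_msupp_eq0; apply/negP => /hf; rewrite mdeg0 => /andP[].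
    by rewrite leqNgt hd.
  by rewrite -[f *: x]/((val f)@_0%MM *: (x : schur k n (ribbon r r'))) f0 scale0r.
- exists (linear_of (monsec_linear hd hr)), (split_lin k n hd hr hr'); split.
  + exact: monsecK.
  + exact: split_bij.
  + move=> x; rewrite -[LHS]/(_, _); congr (_, _).
    * exact: (phi_ribbon_incl hr hr').
    * exact: (ribbon_proj_ribbon_incl hd hr hr').
  + move=> m; rewrite -[LHS]/(_, _); congr (_, _).
    * exact: monsecK.
    * exact: (ribbon_proj_monsec hd hr hr').
  + split; first exact: monsec_graded.
    move=> j t ht; split; first exact: (phi_graded ht).
    exact: (ribbon_proj_graded hd hr hr' ht).
- move=> binU; exists (@gl_sec k n d r r'); split.
  + exact: gl_sec_k_linear.
  + by move=> g _ x; exact: gl_sec_equivariant.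
  + exact: gl_secK.
Qed.
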